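(* Let $\mathcal G$ be a groupoid acting without inversion of edges on a forest $F$ such that for every $x\in\mathcal G^{(0)}$ the fiber $xF$ (with respect to the momentum map) is a tree. Let $\mathfrak D(\mathcal G,F)$ be a desingularization of the action of $\mathcal G$ on $F$, with underlying graph of groupoids $\mathcal G(\Gamma)$ satisfying the wideness assumption and with maximal rooted subtree $T\subseteq\Gamma$. Then $\mathcal G$ is isomorphic, as a groupoid, to the fundamental groupoid $\pi_1(\mathcal G(\Gamma))$ (formed with respect to $T$).
   Context: **Groupoids.** A groupoid $\mathcal G$ is a small category with all morphisms invertible; $\mathcal G^{(0)}$ is its set of objects (units, identified with identity morphisms), $r,s:\mathcal G\to\mathcal G^{(0)}$ are range and source, and $gh$ is defined iff $s(g)=r(h)$. A subgroupoid is wide if it contains all units. **Graphs.** A graph $\Gamma$ (Serre) has a vertex set $\Gamma^0$, an edge set $\Gamma^1$, maps $o,t:\Gamma^1\to\Gamma^0$ and $e\mapsto\bar e$ on $\Gamma^1$ with $\bar e\ne e$, $\bar{\bar e}=e$, $t(\bar e)=o(e)$. A path $e_1\cdots e_n$ satisfies $o(e_i)=t(e_{i+1})$; it is reduced if $e_{i+1}\neq\bar e_i$ for all $i$. A tree is a connected graph whose only reduced closed paths have length $0$; a forest is a graph whose connected components are trees. An orientation $\Gamma^1_+$ contains exactly one edge of each pair $\{e,\bar e\}$. **Actions.** $\mathcal G$ acts on a graph $F$ if there are a surjection $\varphi:F^0\to\mathcal G^{(0)}$ (the momentum) with $\varphi\circ o=\varphi\circ t$, and maps $(g,v)\mapsto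 g\cdot v$ (defined for $v\in F^0$, $s(g)=\varphi(v)$) and $(g,e)\mapsto g\cdot e$ (defined for $e\in F^1$, $s(g)=\varphi(t(e))$) such that: $\varphi(g\cdot v)=r(g)$ and $\varphi(t(g\cdot e))=r(g)$; $g_1\cdot(g_2\cdot y)=(g_1g_2)\cdot y$ whenever $s(g_1)=r(g_2)$ and $g_2\cdot y$ is defined; units act as the identity; $o(g\cdot e)=g\cdot o(e)$ and $t(g\cdot e)=g\cdot t(e)$. The action is without inversion if $g\cdot e\neq\bar e$ always. For $x\in\mathcal G^{(0)}$, $xF$ is the subgraph with vertex set $\varphi^{-1}(x)$ and edge set $t^{-1}(\varphi^{-1}(x))$. The saturation $S(U)$ of a set $U$ of vertices (edges) is the union of the $\mathcal G$-orbits meeting $U$. **Partial sections.** A partial section of $F^0$ (resp. $F^1$) is a map $\sigma:A\to F^0$ (resp. $F^1$), $A\subseteq\mathcal G^{(0)}$, with $\varphi\circ\sigma=\mathrm{id}_A$ (resp. $\varphi\circ t\circ\sigma=\mathrm{id}_A$). Its stabilizer is the subgroupoid $\mathrm{Stab}_{\mathcal G}(\sigma)=\{g\in\mathcal G: s(g),r(g)\in A,\ g\cdot\sigma(s(g))=\sigma(r(g))\}$, with unit space $A$. **Graph of groupoids.** A graph of groupoids $\mathcal G(\Gamma)$ on a connected graph $\Gamma$ consists of groupoids $\mathcal G_v$ ($v\in\Gamma^0$), $\mathcal G_e=\mathcal G_{\bar e}$ ($e\in\Gamma^1$) and injective groupoid homomorphisms $\alpha_e:\mathcal G_e\to\mathcal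 G_{t(e)}$. Wideness assumption: $\alpha_e(\mathcal G_e)$ is a wide subgroupoid of $\mathcal G_{t(e)}$ for all $e\in\Gamma^1$. **Desingularization.** A desingularization of the action of $\mathcal G$ on $F$ consists of: a connected graph $\Gamma$ with orientation $\Gamma^1_+$; a maximal subtree $T\subseteq\Gamma$ (so $T^0=\Gamma^0$) with a root $r\in T^0$; partial sections $\sigma_v:X_v\to F^0$ ($v\in\Gamma^0$) and $\sigma_e:X_e\to F^1$ ($e\in\Gamma^1$) with $X_{\bar e}=X_e$, $\sigma_{\bar e}=\overline{\sigma_e}$; elements $g_{e,x}\in\mathcal G$ for $e\in\Gamma^1_+\setminus T^1$, $x\in X_e$; such that 1. $X_r=\mathcal G^{(0)}$; the saturations $S(\sigma_v(X_v))$, $v\in\Gamma^0$, are pairwise disjoint with union $F^0$; 2. for $e\in T^1$: $X_e\subseteq X_{o(e)}\cap X_{t(e)}$ and $o(\sigma_e(x))=\sigma_{o(e)}(x)$, $t(\sigma_e(x))=\sigma_{t(e)}(x)$ for $x\in X_e$; moreover for $v\in T^0$, $x\in X_v$ one has $x\in X_e$ for every edge $e$ of the reduced path in $T$ from $v$ to $r$; 3. for $e\in\Gamma^1_+\setminus T^1$, $x\in X_e$: $x\in X_{o(e)}$, $o(\sigma_e(x))=\sigma_{o(e)}(x)$, $s(g_{e,x})=x$ and $g_{e,x}\cdot t(\sigma_e(x))\in\sigma_{t(e)}(X_{t(e)})$; 4. the saturations $S(\sigma_e(X_e))$, $e\in\Gamma^1$, are pairwise disjoint with union $F^1$; 5.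 the graph of groupoids $\mathcal G(\Gamma)$ has $\mathcal G_v=\mathrm{Stab}_{\mathcal G}(\sigma_v)$, $\mathcal G_e=\mathcal G_{\bar e}=\mathrm{Stab}_{\mathcal G}(\sigma_e)$ (for $e\in\Gamma^1_+$); $\alpha_e,\alpha_{\bar e}$ are inclusions for $e\in T^1$; for $e\in\Gamma^1_+\setminus T^1$, $\alpha_{\bar e}$ is the inclusion and $\alpha_e(k)=g_{e,r(k)}\,k\,g_{e,s(k)}^{-1}$ (required to be an injective homomorphism into $\mathcal G_{t(e)}$). **Fundamental groupoid.** Let $\mathcal G(\Gamma)$ be a graph of groupoids satisfying the wideness assumption and $T\subseteq\Gamma$ a maximal subtree with root $r$. Put $\mathcal H_e=\alpha_e(\mathcal G_e)$ and $\phi_e=\alpha_e\circ\alpha_{\bar e}^{-1}:\mathcal H_{\bar e}\to\mathcal H_e$; by wideness $\phi_e$ restricts to a bijection $\mathcal G_{o(e)}^{(0)}\to\mathcal G_{t(e)}^{(0)}$. The bijections $\phi_e$, $e\in T^1$, generate an equivalence relation on $\bigsqcup_v\mathcal G_v^{(0)}$ for which $X=\mathcal G_r^{(0)}$ is a set of representatives; let $\tau:\bigsqcup_v\mathcal G_v^{(0)}\to X$ send each element to its representative. $\pi_1(\mathcal G(\Gamma))$ is the groupoid with unit space $X$ presented by: generators all $g\in\mathcal G_v$ ($v\in\Gamma^0$), with range $\tau(r(g))$ and source $\tau(s(g))$, and symbols $(\phi_e(x),x)$, one for each $e\in\Gamma^1$ and $x\in\mathcal G_{o(e)}^{(0)}$,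 with range $\tau(\phi_e(x))$ and source $\tau(x)$; relations: those of the vertex groupoids (a unit $y$ of $\mathcal G_v$ being identified with $\tau(y)$); $(\phi_e(x),x)^{-1}=(x,\phi_e(x))$, the latter being the symbol of $\bar e$ and $\phi_e(x)$; (R1) $(\phi_e(x),x)=\mathrm{id}_{\tau(x)}$ for $e\in T^1$; (R2) $(\alpha_e(r(g)),\alpha_{\bar e}(r(g)))\cdot\alpha_{\bar e}(g)\cdot(\alpha_{\bar e}(s(g)),\alpha_e(s(g)))=\alpha_e(g)$ for $g\in\mathcal G_e$, $e\in\Gamma^1$. *)

(* Defs.v *)
From HB Require Import structures.
From mathcomp Require Import all_boot.
From mathcomp Require Import boolp classical_sets.
From Stdlib Require Import Relation_Operators.
From Stdlib Require List.

Set Implicit Arguments.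
Unset Strict Implicit.
Unset Printing Implicit Defensive.

Local Open Scope classical_set_scope.

(* Units are kept as a separate type [ob], embedded in [arr] by [idm].  The
   product [mul g h] is the groupoid product when [src g = rng h]; outside
   composable pairs its value is unspecified and no law refers to it. *)
Record groupoid := Groupoid {
  ob : Type;
  arr : Type;
  src : arr -> ob;
  rng : arr -> ob;
  idm : ob -> arr;
  mul : arr -> arr -> arr;
  inv : arr -> arr;
  src_idm : forall x, src (idm x) = x;
  rng_idm : forall x, rng (idm x) = x;
  src_mul : forall g h, src g = rng h -> src (mul g h) = src h;
  rng_mul : forall g h, src g = rng h -> rng (mul g h) = rng g;
  mulA : forall g h k, src g = rng h -> src h = rng k ->
    mul g (mul h k) = mul (mul g h) k;
  mul_idl : forall g, mul (idm (rng g)) g = g;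
  mul_idr : forall g, mul g (idm (src g)) = g;
  src_inv : forall g, src (inv g) = rng g;
  rng_inv : forall g, rng (inv g) = src g;
  mulVg : forall g, mul (inv g) g = idm (src g);
  mulgV : forall g, mul g (inv g) = idm (rng g)
}.
Arguments idm {g} x : rename.

Record groupoid_hom (G H : groupoid) := GroupoidHom {
  hom_ob : ob G -> ob H;
  hom_arr :> arr G -> arr H;
  hom_src : forall g, src (hom_arr g) = hom_ob (src g);
  hom_rng : forall g, rng (hom_arr g) = hom_ob (rng g);
  hom_idm : forall x, hom_arr (idm x) = idm (hom_ob x);
  hom_mul : forall g h, src g = rng h ->
    hom_arr (mul g h) = mul (hom_arr g) (hom_arr h)
}.

Definition isomorphic (G H : groupoid) : Prop :=
  exists (f : groupoid_hom G H) (f' : groupoid_hom H G),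
    [/\ cancel (hom_ob f) (hom_ob f'), cancel (hom_ob f') (hom_ob f),
        cancel f f' & cancel f' f].

Record subgroupoid (G : groupoid) := Subgroupoid {
  sub_ob : set (ob G);
  sub_arr : set (arr G);
  sub_src : forall g, sub_arr g -> sub_ob (src g);
  sub_rng : forall g, sub_arr g -> sub_ob (rng g);
  sub_idm : forall x, sub_ob x -> sub_arr (idm x);
  sub_mul : forall g h, sub_arr g -> sub_arr h -> src g = rng h ->
    sub_arr (mul g h);
  sub_inv : forall g, sub_arr g -> sub_arr (inv g)
}.

Lemma sig_eq (T : Type) (P : T -> Prop) (u v : {x | P x}) :
  proj1_sig u = proj1_sig v -> u = v.
Proof. by case: u v => [x p] [y q] /= e; apply: eq_exist. Qed.

Section GroupoidOfSubgroupoid.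
Variables (G : groupoid) (S : subgroupoid G).

Definition sg_ob := {x : ob G | sub_ob S x}.
Definition sg_arr := {g : arr G | sub_arr S g}.
Definition sg_src (g : sg_arr) : sg_ob := exist _ _ (sub_src (proj2_sig g)).
Definition sg_rng (g : sg_arr) : sg_ob := exist _ _ (sub_rng (proj2_sig g)).
Definition sg_idm (x : sg_ob) : sg_arr := exist _ _ (sub_idm (proj2_sig x)).
Definition sg_mul (g h : sg_arr) : sg_arr :=
  match pselect (src (proj1_sig g) = rng (proj1_sig h)) with
  | left p => exist _ _ (sub_mul (proj2_sig g) (proj2_sig h) p)
  | right _ => g
  end.
Definition sg_inv (g : sg_arr) : sg_arr := exist _ _ (sub_inv (proj2_sig g)).

Lemma sg_mulE g h : sg_src g = sg_rng h ->
  proj1_sig (sg_mul g h) = mul (proj1_sig g) (proj1_sig h).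
Proof. by case=> e; rewrite /sg_mul; case: pselect. Qed.

Lemma sg_src_mul g h : sg_src g = sg_rng h -> sg_src (sg_mul g h) = sg_src h.
Proof.
by move=> e; apply: sig_eq; rewrite /= sg_mulE //; case: e; exact: src_mul.
Qed.

Lemma sg_rng_mul g h : sg_src g = sg_rng h -> sg_rng (sg_mul g h) = sg_rng g.
Proof.
by move=> e; apply: sig_eq; rewrite /= sg_mulE //; case: e; exact: rng_mul.
Qed.

Lemma sg_mulA g h k : sg_src g = sg_rng h -> sg_src h = sg_rng k ->
  sg_mul g (sg_mul h k) = sg_mul (sg_mul g h) k.
Proof.
move=> e f; apply: sig_eq.
rewrite !sg_mulE ?sg_rng_mul ?sg_src_mul //.
by case: e f => e [f]; exact: mulA.
Qed.

Lemma sg_mul_idl g : sg_mul (sg_idm (sg_rng g)) g = g.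
Proof.
apply: sig_eq; rewrite sg_mulE ?mul_idl //.
by apply: sig_eq; rewrite /= src_idm.
Qed.

Lemma sg_mul_idr g : sg_mul g (sg_idm (sg_src g)) = g.
Proof.
apply: sig_eq; rewrite sg_mulE ?mul_idr //.
by apply: sig_eq; rewrite /= rng_idm.
Qed.

Lemma sg_mulVg g : sg_mul (sg_inv g) g = sg_idm (sg_src g).
Proof.
apply: sig_eq; rewrite sg_mulE ?mulVg //.
by apply: sig_eq; rewrite /= src_inv.
Qed.

Lemma sg_mulgV g : sg_mul g (sg_inv g) = sg_idm (sg_rng g).
Proof.
apply: sig_eq; rewrite sg_mulE ?mulgV //.
by apply: sig_eq; rewrite /= rng_inv.
Qed.

Definition groupoid_of_subgroupoid : groupoid.
Proof.
refine (@Groupoid sg_ob sg_arr sg_src sg_rng sg_idm sg_mul sg_inv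
  _ _ sg_src_mul sg_rng_mul sg_mulA sg_mul_idl sg_mul_idr _ _
  sg_mulVg sg_mulgV).
- by move=> x; apply: sig_eq; rewrite /= src_idm.
- by move=> x; apply: sig_eq; rewrite /= rng_idm.
- by move=> g; apply: sig_eq; rewrite /= src_inv.
- by move=> g; apply: sig_eq; rewrite /= rng_inv.
Defined.

End GroupoidOfSubgroupoid.
Coercion groupoid_of_subgroupoid : subgroupoid >-> groupoid.

Record graph := Graph {
  vert : Type;
  edge : Type;
  orig : edge -> vert;
  term : edge -> vert;
  bar : edge -> edge;
  bar_neq : forall e, bar e <> e;
  barK : involutive bar;
  term_bar : forall e, term (bar e) = orig e
}.

Lemma orig_bar (F : graph) (e : edge F) : orig (bar e) = term e.
Proof. by rewrite -term_bar barK. Qed.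

(* [is_path v [:: e_1; ...; e_n] w]: a path from v = o(e_n) to w = t(e_1),
   with o(e_i) = t(e_{i+1}). *)
Fixpoint is_path (F : graph) (v : vert F) (p : seq (edge F)) (w : vert F) :
    Prop :=
  match p with
  | [::] => v = w
  | e :: q => term e = w /\ is_path v q (orig e)
  end.

Fixpoint reduced (F : graph) (p : seq (edge F)) : Prop :=
  match p with
  | e :: ((f :: _) as q) => f <> bar e /\ reduced q
  | _ => True
  end.

Definition connected (F : graph) : Prop :=
  forall v w : vert F, exists p, is_path v p w.

Definition is_tree (F : graph) : Prop :=
  connected F /\
  forall (v : vert F) p, is_path v p v -> reduced p -> p = [::].

Record subgraph (F : graph) := Subgraph {
  sub_vert : set (vert F);
  sub_edge : set (edge F);
  sub_orig : forall e, sub_edge e -> sub_vert (orig e);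
  sub_term : forall e, sub_edge e -> sub_vert (term e);
  sub_bar : forall e, sub_edge e -> sub_edge (bar e)
}.

Definition graph_of_subgraph (F : graph) (S : subgraph F) : graph.
Proof.
refine (@Graph {v | sub_vert S v} {e | sub_edge S e}
  (fun e => exist _ _ (sub_orig (proj2_sig e)))
  (fun e => exist _ _ (sub_term (proj2_sig e)))
  (fun e => exist _ _ (sub_bar (proj2_sig e))) _ _ _).
- by move=> e /(congr1 (@proj1_sig _ _)) /bar_neq.
- by move=> e; apply: sig_eq; rewrite /= barK.
- by move=> e; apply: sig_eq; rewrite /= term_bar.
Defined.
Coercion graph_of_subgraph : subgraph >-> graph.

Definition component (F : graph) (v : vert F) : subgraph F.
Proof.
refine (@Subgraph F [set w | exists p, is_path v p w]
  [set e | exists p, is_path v p (orig e)] _ _ _) => //= e [p vp].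
- by exists (e :: p).
- by exists (e :: p); rewrite orig_bar.
Defined.

Definition is_forest (F : graph) : Prop :=
  forall v : vert F, is_tree (component v).

Definition maximal_subtree (F : graph) (T : subgraph F) : Prop :=
  is_tree T /\
  forall T' : subgraph F, is_tree T' ->
    sub_vert T `<=` sub_vert T' -> sub_edge T `<=` sub_edge T' ->
    sub_vert T' `<=` sub_vert T /\ sub_edge T' `<=` sub_edge T.

Record rooted_maximal_subtree (F : graph) := RootedMaximalSubtree {
  rmt_sub :> subgraph F;
  rmt_max : maximal_subtree rmt_sub;
  root : vert F;
  root_in : sub_vert rmt_sub root
}.

Section Spanning.
Variable F : graph.

Fixpoint path_in (S : subgraph F) (p : seq (edge F)) : Prop :=
  if p is e :: q then sub_edge S e /\ path_in S q else True.

Lemma path_in_val (S : subgraph F) (p : seq (edge S)) :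
  path_in S (map (@proj1_sig _ _) p).
Proof. by elim: p => //= -[e Se] p IHp; split. Qed.

Lemma path_in_lift (S : subgraph F) p : path_in S p ->
  exists q : seq (edge S), map (@proj1_sig _ _) q = p.
Proof.
elim: p => [_|e p IHp /= [Se /IHp[q <-]]]; first by exists [::].
by exists (exist _ e Se :: q).
Qed.

Lemma is_path_val (S : subgraph F) (v w : vert S) (p : seq (edge S)) :
  is_path v p w <->
  is_path (proj1_sig v) (map (@proj1_sig _ _) p) (proj1_sig w).
Proof.
elim: p w => [|e p IHp] w /=; split.
- by move->.
- exact: sig_eq.
- by case=> <- /IHp.
- by case=> ew pw; split; [exact: sig_eq|apply/IHp].
Qed.

Lemma reduced_val (S : subgraph F) (p : seq (edge S)) :
  reduced p <-> reduced (map (@proj1_sig _ _) p).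
Proof.
elim: p => //= e [|f p] //= IHp; split; case=> fe /IHp ?; split=> // ef;
  apply: fe; [exact: sig_eq|by rewrite ef].
Qed.

Lemma is_treeP (S : subgraph F) : is_tree S <->
  (forall v w, sub_vert S v -> sub_vert S w ->
     exists2 p, path_in S p & is_path v p w) /\
  (forall v p, sub_vert S v -> path_in S p -> is_path v p v -> reduced p ->
     p = [::]).
Proof.
split=> -[cS tS]; split.
- move=> v w Sv Sw; have [p] := cS (exist _ v Sv) (exist _ w Sw).
  by move=> /is_path_val pvw; exists (map (@proj1_sig _ _) p) => //; exact: path_in_val.
- move=> v p Sv /path_in_lift[q <-] pv /reduced_val rq.
  by rewrite (tS (exist _ v Sv) q) //; apply/is_path_val.
- move=> [v Sv] [w Sw]; have [p /path_in_lift[q <-] pvw] := cS v w Sv Sw.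
  by exists q; apply/is_path_val.
- move=> [v Sv] p /is_path_val pv /reduced_val rp.
  have /(congr1 size) := tS v _ Sv (path_in_val p) pv rp.
  by rewrite size_map; case: p {pv rp}.
Qed.

Lemma path_in_sub (S S' : subgraph F) p :
  sub_edge S `<=` sub_edge S' -> path_in S p -> path_in S' p.
Proof. by move=> SS'; elim: p => //= e p IHp [/SS' ? /IHp]. Qed.

Lemma is_path_cat (u v w : vert F) p q :
  is_path v p w -> is_path u q v -> is_path u (p ++ q) w.
Proof.
elim: p w => [|e p IHp] w /=; first by move=> <-.
by case=> ew vp uq; split=> //; exact: IHp.
Qed.

Lemma is_path_rconsP (u w : vert F) p e :
  is_path u (rcons p e) w <-> is_path (term e) p w /\ orig e = u.
Proof.
elim: p w => [|f p IHp] w /=; split.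
- by case=> -> ->.
- by case=> -> ->.
- by case=> fw /IHp[].
- by case=> -[fw pf] eu; split=> //; apply/IHp.
Qed.

Lemma path_in_cat (S : subgraph F) p q :
  path_in S (p ++ q) <-> path_in S p /\ path_in S q.
Proof. by elim: p => /= [|e p ->]; tauto. Qed.

Lemma reduced_rcons (p : seq (edge F)) e : reduced (rcons p e) -> reduced p.
Proof. by elim: p => //= f [//|g p] /= IHp [? /IHp]. Qed.

Lemma reduced_cons e (p : seq (edge F)) : reduced (e :: p) -> reduced p.
Proof. by case: p => //= f p []. Qed.

Section AddEdge.
Variables (T : subgraph F) (e : edge F).
Hypotheses (Te : sub_vert T (orig e)) (nTe : ~ sub_vert T (term e)).

Definition add_edge : subgraph F.
Proof.
refine (@Subgraph F [set v | sub_vert T v \/ v = term e]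
  [set f | [\/ sub_edge T f, f = e | f = bar e]] _ _ _).
- move=> f [Tf|->|->]; rewrite /= ?orig_bar; [|by left|by right].
  by left; exact: sub_orig.
- move=> f [Tf|->|->]; rewrite /= ?term_bar; [|by right|by left].
  by left; exact: sub_term.
- move=> f [Tf|->|->].
  + by constructor 1; exact: sub_bar.
  + by constructor 3.
  + by constructor 2; rewrite barK.
Defined.

Lemma add_edge_old v p w : sub_vert T v -> sub_vert T w ->
  path_in add_edge p -> is_path v p w -> reduced p -> path_in T p.
Proof.
move=> Tv; elim: p w => //= f q IHq w Tw [Ef Eq] [fw vq] rfq.
have rq := reduced_cons rfq.
case: Ef fw vq rfq => [Tf|->|->] fw vq rfq.
- by split=> //; apply: IHq vq rq => //; exact: sub_orig.
- by case: nTe; rewrite fw.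
case: q {IHq rq} Eq vq rfq => [_ /= vf _|f' q [Ef' _] [f'w _] [nf' _]].
  by case: nTe; rewrite -(orig_bar e) -vf.
case: Ef' f'w nf' => [Tf'|->|->] f'w nf'.
- by case: nTe; rewrite -(orig_bar e) -f'w; exact: sub_term.
- by case: nf'; rewrite barK.
- by case: nTe; rewrite -(orig_bar e) -f'w term_bar.
Qed.

Lemma add_edge_new p w : sub_vert T w ->
  path_in add_edge p -> is_path (term e) p w -> reduced p ->
  exists2 q, p = rcons q (bar e) & path_in T q /\ is_path (orig e) q w.
Proof.
elim: p w => [w Tw _ /= ew|f p IHp w Tw [Ef Ep] [fw vp] rfp].
  by case: nTe; rewrite ew.
have rp := reduced_cons rfp.
case: Ef fw vp rfp => [Tf|->|->] fw vp rfp.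
- have [q -> [Tq vq]] := IHp _ (sub_orig Tf) Ep vp rp.
  by exists (f :: q).
- by case: nTe; rewrite fw.
case: p {IHp rp} Ep vp rfp => [_ _ _|f' p [Ef' _] [f'w _] [nf' _]].
  by exists [::] => //=; rewrite -term_bar.
case: Ef' f'w nf' => [Tf'|->|->] f'w nf'.
- by case: nTe; rewrite -(orig_bar e) -f'w; exact: sub_term.
- by case: nf'; rewrite barK.
- by case: nTe; rewrite -(orig_bar e) -f'w term_bar.
Qed.

Lemma add_edge_tree : is_tree T -> is_tree add_edge.
Proof.
move=> /is_treeP[cT tT]; apply/is_treeP.
have sTE : sub_edge T `<=` sub_edge add_edge by move=> f; constructor 1.
split.
- have toT v w : sub_vert T v -> sub_vert add_edge w ->
    exists2 p, path_in add_edge p & is_path v p w.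
    move=> Tv [Tw|->].
      by have [p Tp vp] := cT v w Tv Tw; exists p => //; exact: path_in_sub Tp.
    have [p Tp vp] := cT v _ Tv Te; exists (e :: p) => //=.
    by split; [constructor 2|exact: path_in_sub Tp].
  move=> v w [Tv|->] Ew; first exact: toT.
  have [p Ep vp] := toT _ w Te Ew; exists (rcons p (bar e)).
    by rewrite -cats1; apply/path_in_cat; do 2!split => //; constructor 3.
  by apply/is_path_rconsP; rewrite term_bar orig_bar.
- move=> v p [Tv|->] Ep vp rp.
    by apply: (tT v) => //; exact: add_edge_old vp rp.
  case: p Ep vp rp => //= f p [Ef Ep] [fw vp] rfp.
  have {Ef} fe : f = e.
    case: Ef fw => [Tf|//|->] fw.
      by case: nTe; rewrite -fw; exact: sub_term.
    by case: nTe; rewrite -fw term_bar.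
  move: fe fw vp rfp => -> {f} _ vp rfp.
  have [q qE [Tq vq]] := add_edge_new Te Ep vp (reduced_cons rfp).
  have rq : reduced q.
    by move: (reduced_cons rfp); rewrite qE => /reduced_rcons.
  by move: rfp; rewrite qE (tT _ q Te) //= => -[].
Qed.

End AddEdge.

Lemma maximal_subtree_spanning (T : rooted_maximal_subtree F) :
  connected F -> forall v, sub_vert T v.
Proof.
move=> cF v; have [p] := cF (root T) v.
elim: p v => [|e p IHp] v /=; first by move=> <-; exact: root_in.
case=> <- /IHp Te; apply: contrapT => nTe.
have [tT /(_ (add_edge Te))] := rmt_max T.
case=> [|v' Tv'|f Tf|sT _].
- exact: add_edge_tree.
- by left.
- by constructor 1.
- by apply: nTe; apply: sT; right.
Qed.

End Spanning.

Record set_action (G : groupoid) (Y : Type) (m : Y -> ob G) := SetAction {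
  act :> arr G -> Y -> Y;
  act_mom : forall g y, src g = m y -> m (act g y) = rng g;
  act_mul : forall g1 g2 y, src g1 = rng g2 -> src g2 = m y ->
    act g1 (act g2 y) = act (mul g1 g2) y;
  act_idm : forall y, act (idm (m y)) y = y
}.

(* No compatibility of the action with [bar] is required; it follows from the
   other laws as soon as the fibers are trees. *)
Record graph_action (G : groupoid) (F : graph) := GraphAction {
  mom : vert F -> ob G;
  mom_surj : forall x, exists v, mom v = x;
  mom_edge : forall e, mom (orig e) = mom (term e);
  vact : set_action mom;
  eact : set_action (fun e : edge F => mom (term e));
  orig_act : forall g e, src g = mom (term e) ->
    orig (eact g e) = vact g (orig e);
  term_act : forall g e, src g = mom (term e) ->
    term (eact g e) = vact g (term e)
}.

Definition without_inversion (G : groupoid) (F : graph)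
    (A : graph_action G F) : Prop :=
  forall g e, src g = mom A (term e) -> eact A g e <> bar e.

Definition fiber (G : groupoid) (F : graph) (A : graph_action G F)
    (x : ob G) : subgraph F.
Proof.
refine (@Subgraph F [set v | mom A v = x] [set e | mom A (term e) = x]
  _ _ _) => //= e.
- by rewrite mom_edge.
- by rewrite term_bar mom_edge.
Defined.

Section Sections.
Variables (G : groupoid) (Y : Type) (m : Y -> ob G) (A : set_action m).

Definition saturation (U : set Y) : set Y :=
  [set y | exists2 u, U u & exists2 g, src g = m u & A g u = y].

(* The domain of a partial section is the set of units not sent to None. *)
Record partial_section := PartialSection {
  psec :> ob G -> option Y;
  psecP : forall x y, psec x = Some y -> m y = x
}.

Definition pdom (s : partial_section) : set (ob G) := [set x | s x].

Definition pimage (s : partial_section) : set Y :=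
  [set y | exists x, s x = Some y].

Variable s : partial_section.

Definition stab_arr : set (arr G) :=
  [set g | exists2 y, s (src g) = Some y & s (rng g) = Some (A g y)].

Lemma stab_src g : stab_arr g -> pdom s (src g).
Proof. by rewrite /pdom/=; case=> y ->. Qed.

Lemma stab_rng g : stab_arr g -> pdom s (rng g).
Proof. by rewrite /pdom/=; case=> y _ ->. Qed.

Lemma stab_idm x : pdom s x -> stab_arr (idm x).
Proof.
rewrite /pdom /stab_arr /= src_idm rng_idm; case E: (s x) => [y|//] _.
by exists y => //; rewrite -(psecP E) act_idm.
Qed.

Lemma stab_mul g h : stab_arr g -> stab_arr h -> src g = rng h ->
  stab_arr (mul g h).
Proof.
case=> y gy gy' [z hz hz'] gh; exists z; first by rewrite src_mul.
move: gy gy'; rewrite gh hz' => -[<-]; rewrite rng_mul // act_mul //.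
by rewrite (psecP hz).
Qed.

Lemma stab_inv g : stab_arr g -> stab_arr (inv g).
Proof.
case=> y gy gy'; exists (A g y); first by rewrite src_inv.
have my := psecP gy.
rewrite rng_inv act_mul ?src_inv // mulVg; move: gy; rewrite -my => ->.
by rewrite act_idm.
Qed.

Definition Stab : subgroupoid G :=
  Subgroupoid stab_src stab_rng stab_idm stab_mul stab_inv.

End Sections.

(* [alpha e] has codomain the vertex groupoid at t(e).  The requirement
   G_e = G_(bar e) is an equality of groupoids. *)
Record graph_of_groupoids (F : graph) := GraphOfGroupoids {
  gog_connected : connected F;
  vgrp : vert F -> groupoid;
  egrp : edge F -> groupoid;
  egrp_bar : forall e, egrp (bar e) = egrp e;
  alpha : forall e, groupoid_hom (egrp e) (vgrp (term e));
  alpha_inj : forall e, injective (alpha e)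
}.

Definition hom_cast (H G G' : groupoid) (E : G = G') (f : groupoid_hom G H) :
    groupoid_hom G' H :=
  eq_rect G (fun K => groupoid_hom K H) f G' E.

(* The image of the injective [alpha GG e] is a subgroupoid; it is wide when
   it contains every unit. *)
Definition wide (F : graph) (GG : graph_of_groupoids F) : Prop :=
  forall e (y : ob (vgrp GG (term e))), exists k, alpha GG e k = idm y.

Section Pi1.
Variables (F : graph) (GG : graph_of_groupoids F).

(* The homomorphism of the edge bar e, seen on the groupoid G_e = G_(bar e);
   it lands in the vertex groupoid at o(e) = t(bar e). *)
Definition alpha_bar (e : edge F) :
    groupoid_hom (egrp GG e) (vgrp GG (term (bar e))) :=
  hom_cast (egrp_bar GG e) (alpha GG (bar e)).

(* The disjoint union of the unit spaces of the vertex groupoids. *)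
Definition units : Type := {v : vert F & ob (vgrp GG v)}.
Definition unit_at (v : vert F) (x : ob (vgrp GG v)) : units := existT _ v x.

(* [phi e x y] means y = phi_e(x): it is the graph of the restriction of
   alpha_e o alpha_(bar e)^-1 to units. *)
Definition phi (e : edge F) (x y : units) : Prop :=
  exists z : ob (egrp GG e),
    unit_at (hom_ob (alpha_bar e) z) = x /\
    unit_at (hom_ob (alpha GG e) z) = y.

Lemma phi_sym e x y : phi e x y -> phi (bar e) y x.
Proof.
case=> z [<- <-]; rewrite /phi /alpha_bar.
move: z (egrp_bar GG e) (egrp_bar GG (bar e)).
move: (barK e); move: (bar (bar e)) => e' ee'; case: e / ee'.
move: (alpha GG (bar e')) (alpha GG e').
move: (egrp GG (bar e')) (egrp GG e') => B C f f' z p.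
case: C / p f' z => f' z q.
by rewrite (Prop_irrelevance q erefl); exists z.
Qed.

Lemma phi_alpha e (z : ob (egrp GG e)) :
  phi e (unit_at (hom_ob (alpha_bar e) z)) (unit_at (hom_ob (alpha GG e) z)).
Proof. by exists z. Qed.

Variable wGG : wide GG.

Lemma wide_ob e (y : ob (vgrp GG (term e))) :
  exists z, hom_ob (alpha GG e) z = y.
Proof.
have [k kE] := wGG y; exists (src k).
by rewrite -hom_src kE src_idm.
Qed.

Lemma phi_total_bar e (x : ob (vgrp GG (term e))) :
  exists y : ob (vgrp GG (term (bar e))), phi (bar e) (unit_at x) (unit_at y).
Proof.
have [z <-] := wide_ob x; exists (hom_ob (alpha_bar e) z).
by apply: phi_sym; exists z.
Qed.

Lemma phi_total e (x : ob (vgrp GG (orig e))) :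
  exists y : ob (vgrp GG (term e)), phi e (unit_at x) (unit_at y).
Proof.
move: x; rewrite -term_bar => x; have [y] := phi_total_bar x.
by move: y; rewrite barK => y; exists y.
Qed.

Variable T : rooted_maximal_subtree F.

Definition tree_equiv : units -> units -> Prop :=
  clos_refl_sym_trans units (fun x y => exists2 e, sub_edge T e & phi e x y).

Lemma tree_equiv_root (x : units) :
  exists x0 : ob (vgrp GG (root T)), tree_equiv x (unit_at x0).
Proof.
case: x => v x.
have [/is_treeP[cT _] _] := rmt_max T.
have sT := maximal_subtree_spanning T (gog_connected GG).
have [p Tp vp] := cT v (root T) (sT v) (sT _).
elim: p (root T) Tp vp => /= [w _ <-|e p IHp w [Te Tp] [<- vp]].
  by exists x; exact: rst_refl.
have [y xy] := IHp _ Tp vp; have [z yz] := phi_total y.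
by exists z; apply: rst_trans xy _; apply: rst_step; exists e.
Qed.

(* The representative in the root vertex groupoid; it is unique because the
   tree T has no reduced closed path and the [phi e] are bijective. *)
Definition tau (x : units) : ob (vgrp GG (root T)) :=
  projT1 (cid (tree_equiv_root x)).

End Pi1.

Section Presented.
Variables (X gen : Type) (grng gsrc : gen -> X).

(* The letter (a, true) stands for a and (a, false) for its inverse. *)
Definition letter : Type := (gen * bool)%type.
Definition lrng (a : letter) := if a.2 then grng a.1 else gsrc a.1.
Definition lsrc (a : letter) := if a.2 then gsrc a.1 else grng a.1.
Definition linv (a : letter) : letter := (a.1, ~~ a.2).

Fixpoint chain (y : X) (l : seq letter) (x : X) : Prop :=
  if l is a :: l' then lrng a = y /\ chain (lsrc a) l' x else y = x.

Variable rel : seq letter -> seq letter -> Prop.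

(* Composable words: [wseq] goes from [wsrc] to [wrng]; the empty word with
   both ends x stands for the unit x. *)
Record word := Word {
  wrng : X;
  wseq : seq letter;
  wsrc : X;
  wchain : chain wrng wseq wsrc
}.

HB.instance Definition _ := gen_eqMixin word.
HB.instance Definition _ := gen_choiceMixin word.

Inductive elementary : seq letter -> seq letter -> Prop :=
| elem_rel l l' : rel l l' -> elementary l l'
| elem_inv a : elementary [:: a; linv a] [::].

Definition wstep (w w' : word) : Prop :=
  [/\ wrng w = wrng w', wsrc w = wsrc w' &
      exists u v l l', [/\ elementary l l',
        wseq w = u ++ l ++ v & wseq w' = u ++ l' ++ v]].

Definition weq : word -> word -> Prop := clos_refl_sym_trans word wstep.

Definition weqb (w w' : word) : bool := `[< weq w w' >].

Lemma weqb_refl : reflexive weqb.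
Proof. by move=> w; apply/asboolP; exact: rst_refl. Qed.

Lemma weqb_sym : symmetric weqb.
Proof. by move=> w w'; apply/asboolP/asboolP; exact: rst_sym. Qed.

Lemma weqb_trans : transitive weqb.
Proof.
by move=> w w1 w2 /asboolP h /asboolP h'; apply/asboolP; exact: rst_trans h h'.
Qed.

Canonical weq_equiv := EquivRel weqb weqb_refl weqb_sym weqb_trans.

Local Open Scope quotient_scope.

Definition warr := {eq_quot weq_equiv}.

Lemma weqP w w' : weq w w' <-> \pi_warr w = \pi_warr w'.
Proof. by split=> [h|/eqmodP/asboolP//]; apply/eqmodP/asboolP. Qed.

Lemma weq_repr w : weq w (repr (\pi_warr w)).
Proof. by apply/weqP; rewrite reprK. Qed.

Lemma weq_ends w w' : weq w w' -> wrng w = wrng w' /\ wsrc w = wsrc w'.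
Proof.
elim=> {w w'} [w w' []//|//|w w' _ [-> ->]//|w1 w2 w3 _ [-> ->] _ [-> ->]//].
Qed.

Lemma word_eq w w' : wrng w = wrng w' -> wseq w = wseq w' -> wsrc w = wsrc w' ->
  w = w'.
Proof.
case: w w' => [y l x c] [y' l' x' c'] /= yy' ll' xx'.
case: y' / yy' c'; case: l' / ll'; case: x' / xx' => c'.
by rewrite (Prop_irrelevance c c').
Qed.

Lemma chain_cat y l m l' x : chain y l m -> chain m l' x -> chain y (l ++ l') x.
Proof. by elim: l y => [y ->//|a l IHl y /= [? ?] ?]; split=> //; exact: IHl. Qed.

Lemma linvK : involutive linv.
Proof. by case=> a b; rewrite /linv negbK. Qed.

Lemma lrng_inv a : lrng (linv a) = lsrc a. Proof. by case: a => a []. Qed.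
Lemma lsrc_inv a : lsrc (linv a) = lrng a. Proof. by case: a => a []. Qed.

Lemma chain_rev y l x : chain y l x -> chain x (rev (map linv l)) y.
Proof.
elim: l y => [y ->//|a l IHl y /= [<- /IHl cl]].
rewrite rev_cons -cats1; apply: chain_cat cl _ => /=.
by rewrite lrng_inv lsrc_inv.
Qed.

Definition wnil (x : X) : word := @Word x [::] x erefl.

Lemma wcat_chain w w' : wsrc w = wrng w' ->
  chain (wrng w) (wseq w ++ wseq w') (wsrc w').
Proof.
by move=> e; apply: chain_cat (wchain w) _; rewrite e; exact: wchain.
Qed.

Definition wcat (w w' : word) : word :=
  if pselect (wsrc w = wrng w') is left e then Word (wcat_chain e) else w.

Definition winv (w : word) : word := Word (chain_rev (wchain w)).

Lemma wcatE w w' : wsrc w = wrng w' ->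
  [/\ wrng (wcat w w') = wrng w, wsrc (wcat w w') = wsrc w' &
      wseq (wcat w w') = wseq w ++ wseq w'].
Proof. by rewrite /wcat; case: pselect. Qed.

Lemma wstep_weq w w' : wstep w w' -> weq w w'. Proof. exact: rst_step. Qed.

Lemma weq_catl w1 w2 w : weq w1 w2 -> wsrc w1 = wrng w ->
  weq (wcat w1 w) (wcat w2 w).
Proof.
elim=> {w1 w2} [w1 w2 s|w1|w1 w2 h IH|w1 w2 w3 h IH h' IH'] e.
- have [er es [u [v [l [l' [ell' e1 e2]]]]]] := s.
  have [r1 s1 q1] := wcatE e; have [r2 s2 q2] := wcatE (etrans (esym es) e).
  apply: wstep_weq; split; rewrite ?r1 ?r2 ?s1 ?s2 //.
  by exists u, (v ++ wseq w), l, l'; rewrite q1 q2 e1 e2 -!catA.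
- exact: rst_refl.
- by apply: rst_sym; apply: IH; rewrite (weq_ends h).2.
- by apply: rst_trans (IH e) _; apply: IH'; rewrite -(weq_ends h).2.
Qed.

Lemma weq_catr w1 w2 w : weq w1 w2 -> wsrc w = wrng w1 ->
  weq (wcat w w1) (wcat w w2).
Proof.
elim=> {w1 w2} [w1 w2 s|w1|w1 w2 h IH|w1 w2 w3 h IH h' IH'] e.
- have [er es [u [v [l [l' [ell' e1 e2]]]]]] := s.
  have [r1 s1 q1] := wcatE e; have [r2 s2 q2] := wcatE (etrans e er).
  apply: wstep_weq; split; rewrite ?r1 ?r2 ?s1 ?s2 //.
  by exists (wseq w ++ u), v, l, l'; rewrite q1 q2 e1 e2 -!catA.
- exact: rst_refl.
- by apply: rst_sym; apply: IH; rewrite (weq_ends h).1.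
- by apply: rst_trans (IH e) _; apply: IH'; rewrite -(weq_ends h).1.
Qed.

Lemma weq_cat w1 w2 w1' w2' : weq w1 w1' -> weq w2 w2' -> wsrc w1 = wrng w2 ->
  weq (wcat w1 w2) (wcat w1' w2').
Proof.
move=> h1 h2 e; apply: rst_trans (weq_catl h1 e) _; apply: weq_catr => //.
by rewrite -(weq_ends h1).2.
Qed.

Lemma wcat_inv w : weq (wcat w (winv w)) (wnil (wrng w)).
Proof.
case: w => y l x c.
have [n] := ubnP (size l); elim: n => // n IHn in y l x c *.
case/lastP: l c => [c _|l a c].
  rewrite (_ : wcat _ _ = wnil y); first exact: rst_refl.
  by have [//|r s q] := @wcatE (Word c) (winv (Word c)); apply: word_eq; rewrite ?r ?s ?q.
rewrite size_rcons ltnS => sl.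
have c' : chain y l (lrng a).
  elim: {sl} l y c => [y /= [//]|b l IHl y /= [? ?]]; by split=> //; exact: IHl.
have := IHn y l _ c' sl; apply: rst_trans; apply: wstep_weq.
have [//|r s q] := @wcatE (Word c) (winv (Word c)).
have [//|r' s' q'] := @wcatE (Word c') (winv (Word c')).
split; rewrite ?r ?s ?r' ?s' ?q ?q' //.
exists l, (rev (map linv l)), [:: a; linv a], [::]; split; first exact: elem_inv.
  by rewrite /= map_rcons rev_rcons cat_rcons.
by [].
Qed.

Lemma winvK w : winv (winv w) = w.
Proof.
case: w => y l x c; apply: word_eq => //=.
by rewrite map_rev revK mapK //; exact: linvK.
Qed.

Lemma winv_cat w : weq (wcat (winv w) w) (wnil (wsrc w)).
Proof. by have := wcat_inv (winv w); rewrite winvK. Qed.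

Definition parr_rng (g : warr) : X := wrng (repr g).
Definition parr_src (g : warr) : X := wsrc (repr g).
Definition parr_idm (x : X) : warr := \pi_warr (wnil x).
Definition parr_mul (g h : warr) : warr := \pi_warr (wcat (repr g) (repr h)).
Definition parr_inv (g : warr) : warr := \pi_warr (winv (repr g)).

Lemma parr_rng_pi w : parr_rng (\pi_warr w) = wrng w.
Proof. by have [] := weq_ends (weq_repr w). Qed.

Lemma parr_src_pi w : parr_src (\pi_warr w) = wsrc w.
Proof. by have [] := weq_ends (weq_repr w). Qed.

Lemma parr_mul_pi w w' : wsrc w = wrng w' ->
  parr_mul (\pi_warr w) (\pi_warr w') = \pi_warr (wcat w w').
Proof.
move=> e; apply/weqP; apply: rst_sym; apply: weq_cat e; exact: weq_repr.
Qed.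

Definition presented_groupoid : groupoid.
Proof.
refine (@Groupoid X warr parr_src parr_rng parr_idm parr_mul parr_inv
  _ _ _ _ _ _ _ _ _ _ _).
- by move=> x; rewrite parr_src_pi.
- by move=> x; rewrite parr_rng_pi.
- by move=> g h e; rewrite parr_src_pi; have [] := wcatE e.
- by move=> g h e; rewrite parr_rng_pi; have [] := wcatE e.
- move=> g h k e f.
  have [r s q] := wcatE e; have [r' s' q'] := wcatE f.
  rewrite -[g in LHS]reprK -[k in RHS]reprK {1}/parr_mul /parr_mul.
  have e1 : wsrc (repr g) = wrng (wcat (repr h) (repr k)) by rewrite r'.
  have e2 : wsrc (wcat (repr g) (repr h)) = wrng (repr k) by rewrite s.
  rewrite -!/(parr_mul _ _) !reprK -{1}[g]reprK -{2}[k]reprK.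
  rewrite [LHS](parr_mul_pi e1) [RHS](parr_mul_pi e2); congr (\pi_warr _).
  have [r1 s1 q1] := wcatE e1; have [r2 s2 q2] := wcatE e2.
  by apply: word_eq; rewrite ?r1 ?s1 ?q1 ?r2 ?s2 ?q2 ?r ?s ?q ?r' ?s' ?q' ?catA.
- move=> g; rewrite -{2}[g]reprK /parr_idm parr_mul_pi //.
  rewrite -[RHS]reprK; congr (\pi_warr _).
  by have [//|r s q] := @wcatE (wnil (parr_rng g)) (repr g); apply: word_eq;
    rewrite ?r ?s ?q.
- move=> g; rewrite -{1}[g]reprK /parr_idm parr_mul_pi //.
  rewrite -[RHS]reprK; congr (\pi_warr _).
  by have [//|r s q] := @wcatE (repr g) (wnil (parr_src g)); apply: word_eq;
    rewrite ?r ?s ?q // cats0.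
- by move=> g; rewrite parr_src_pi.
- by move=> g; rewrite parr_rng_pi.
- move=> g; rewrite -{2}[g]reprK parr_mul_pi //; apply/weqP; exact: winv_cat.
- move=> g; rewrite -{1}[g]reprK parr_mul_pi //; apply/weqP; exact: wcat_inv.
Defined.

End Presented.

Section FundamentalGroupoid.
Variables (F : graph) (GG : graph_of_groupoids F) (wGG : wide GG).
Variable T : rooted_maximal_subtree F.

(* [Sgen p], for p : phi e x y, is the symbol (phi_e(x), x) = (y, x) of the
   edge e. *)
Inductive pi1_gen : Type :=
| Vgen (v : vert F) (g : arr (vgrp GG v))
| Sgen (e : edge F) (x y : units GG) (p : phi e x y).

Definition pi1_gen_rng (a : pi1_gen) : ob (vgrp GG (root T)) :=
  match a with
  | Vgen v g => tau wGG T (unit_at (rng g))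
  | Sgen e x y _ => tau wGG T y
  end.

Definition pi1_gen_src (a : pi1_gen) : ob (vgrp GG (root T)) :=
  match a with
  | Vgen v g => tau wGG T (unit_at (src g))
  | Sgen e x y _ => tau wGG T x
  end.

Definition lpos (a : pi1_gen) : letter pi1_gen := (a, true).
Definition lneg (a : pi1_gen) : letter pi1_gen := (a, false).

Inductive pi1_rel : seq (letter pi1_gen) -> seq (letter pi1_gen) -> Prop :=
| rel_mul v (g h : arr (vgrp GG v)) : src g = rng h ->
    pi1_rel [:: lpos (Vgen g); lpos (Vgen h)] [:: lpos (Vgen (mul g h))]
| rel_unit v (y : ob (vgrp GG v)) :
    pi1_rel [:: lpos (Vgen (idm y))] [::]
| rel_inv e x y (p : phi e x y) :
    pi1_rel [:: lneg (Sgen p)] [:: lpos (Sgen (phi_sym p))]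
| rel_R1 e x y (p : phi e x y) : sub_edge T e ->
    pi1_rel [:: lpos (Sgen p)] [::]
| rel_R2 e (g : arr (egrp GG e)) :
    pi1_rel [:: lpos (Sgen (phi_alpha (rng g))); lpos (Vgen (alpha_bar GG e g));
                lpos (Sgen (phi_sym (phi_alpha (src g))))]
            [:: lpos (Vgen (alpha GG e g))].

Definition pi1 : groupoid := presented_groupoid pi1_gen_rng pi1_gen_src pi1_rel.

End FundamentalGroupoid.

Section Desingularization.
Variables (G : groupoid) (F : graph) (A : graph_action G F).

(* The sections are option-valued, so that an equation such as
   [sigv (orig e) x = Some (orig f)] includes that x is in the domain. *)
Record desingularization := Desingularization {
  dgraph : graph;
  dconnected : connected dgraph;
  positive : edge dgraph -> bool;
  positive_bar : forall e, positive (bar e) = ~~ positive e;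
  dtree : rooted_maximal_subtree dgraph;
  sigv : vert dgraph -> partial_section (mom A);
  sige : edge dgraph -> partial_section (fun f : edge F => mom A (term f));
  sige_bar : forall e x, sige (bar e) x = omap (@bar F) (sige e x);
  (* Only used for e positive outside the tree and x in the domain of
     [sige e]. *)
  dg : edge dgraph -> ob G -> arr G;
  sigv_root : pdom (sigv (root dtree)) = [set: ob G];
  sigv_disjoint : trivIset [set: vert dgraph]
    (fun v => saturation (vact A) (pimage (sigv v)));
  sigv_cover : \bigcup_(v in [set: vert dgraph])
    saturation (vact A) (pimage (sigv v)) = [set: vert F];
  tree_orig : forall e x f, sub_edge dtree e -> sige e x = Some f ->
    sigv (orig e) x = Some (orig f);
  tree_term : forall e x f, sub_edge dtree e -> sige e x = Some f ->
    sigv (term e) x = Some (term f);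
  tree_dom : forall (v r : vert dtree) (p : seq (edge dtree)) x,
    proj1_sig r = root dtree -> is_path v p r -> reduced p ->
    pdom (sigv (proj1_sig v)) x ->
    forall e, List.In e p -> pdom (sige (proj1_sig e)) x;
  nontree_orig : forall e x f, positive e -> ~ sub_edge dtree e ->
    sige e x = Some f -> sigv (orig e) x = Some (orig f);
  dg_src : forall e x, positive e -> ~ sub_edge dtree e ->
    pdom (sige e) x -> src (dg e x) = x;
  dg_term : forall e x f, positive e -> ~ sub_edge dtree e ->
    sige e x = Some f ->
    pimage (sigv (term e)) (vact A (dg e x) (term f));
  sige_disjoint : trivIset [set: edge dgraph]
    (fun e => saturation (eact A) (pimage (sige e)));
  sige_cover : \bigcup_(e in [set: edge dgraph])
    saturation (eact A) (pimage (sige e)) = [set: edge F];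
  (* Injectivity of alpha_e.  That alpha_e is a homomorphism into the vertex
     groupoid at t(e) is a consequence of the other fields: see [dalpha]. *)
  dg_inj : forall e, positive e -> ~ sub_edge dtree e ->
    forall k l, stab_arr (eact A) (sige e) k -> stab_arr (eact A) (sige e) l ->
    mul (mul (dg e (rng k)) k) (inv (dg e (src k))) =
    mul (mul (dg e (rng l)) l) (inv (dg e (src l))) -> k = l
}.

Variable D : desingularization.
Notation Gam := (dgraph D).
Notation Tr := (dtree D).

Definition pos_edge (e : edge Gam) : edge Gam :=
  if positive e then e else bar e.

Lemma pos_edge_bar e : pos_edge (bar e) = pos_edge e.
Proof. by rewrite /pos_edge positive_bar barK; case: positive. Qed.

Definition vstab (v : vert Gam) : subgroupoid G := Stab (vact A) (sigv v).
Definition estab (e : edge Gam) : subgroupoid G :=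
  Stab (eact A) (sige (pos_edge e)).

Definition twisted (e : edge Gam) : bool :=
  positive e && ~~ `[< sub_edge Tr e >].

(* For e positive outside the tree, alpha_e(k) = g_{e,r(k)} k g_{e,s(k)}^-1;
   for every other edge alpha_e is the inclusion. *)
Definition dalpha_ob (e : edge Gam) (x : ob G) : ob G :=
  if twisted e then rng (dg e x) else x.

Definition dalpha_arr (e : edge Gam) (k : arr G) : arr G :=
  if twisted e then mul (mul (dg e (rng k)) k) (inv (dg e (src k))) else k.

Lemma twistedP e : reflect (positive e /\ ~ sub_edge Tr e) (twisted e).
Proof.
apply: (iffP andP) => -[pe]; first by move/asboolPn.
by move=> nTe; split=> //; apply/asboolPn.
Qed.

Lemma act_end g f (b : bool) : src g = mom A (term f) ->
  (if b then term (eact A g f) else orig (eact A g f)) =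
  vact A g (if b then term f else orig f).
Proof. by case: b => e; [exact: term_act|exact: orig_act]. Qed.

Lemma untwisted_sec e x f : ~~ twisted e -> sige (pos_edge e) x = Some f ->
  sigv (term e) x = Some (if positive e then term f else orig f).
Proof.
move=> /twistedP nt; rewrite /pos_edge; case: ifP => pe xf.
  by apply: tree_term xf; apply: contrapT => nTe; apply: nt.
have [Te|nTe] := pselect (sub_edge Tr e); rewrite -(orig_bar e).
  by apply: tree_orig xf; exact: sub_bar.
apply: nontree_orig xf; first by rewrite positive_bar pe.
by move=> /sub_bar; rewrite barK.
Qed.

Lemma twisted_sec e x f : twisted e -> sige (pos_edge e) x = Some f ->
  src (dg e x) = x /\
  sigv (term e) (rng (dg e x)) = Some (vact A (dg e x) (term f)).
Proof.
move=> /twistedP[pe nTe]; rewrite /pos_edge pe => xf.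
have sx : src (dg e x) = x by apply: dg_src => //; rewrite /pdom/= xf.
have [y yE] := dg_term pe nTe xf.
have := act_mom (vact A) (etrans sx (esym (psecP xf))).
by rewrite (psecP yE) => <-.
Qed.

Lemma twisted_src e k : twisted e -> sub_arr (estab e) k ->
  src (dg e (src k)) = src k /\ src (dg e (rng k)) = rng k.
Proof.
by move=> te [y /(twisted_sec te)[-> _] /(twisted_sec te)[-> _]].
Qed.

Lemma twisted_mul e k : twisted e -> sub_arr (estab e) k ->
  src (mul (dg e (rng k)) k) = rng (inv (dg e (src k))).
Proof.
by move=> te /(twisted_src te)[es er]; rewrite src_mul // rng_inv es.
Qed.

Lemma dalpha_src e k : sub_arr (estab e) k ->
  src (dalpha_arr e k) = dalpha_ob e (src k).
Proof.
rewrite /dalpha_arr /dalpha_ob => ek; case: ifP => // te.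
by rewrite src_mul ?src_inv //; exact: twisted_mul.
Qed.

Lemma dalpha_rng e k : sub_arr (estab e) k ->
  rng (dalpha_arr e k) = dalpha_ob e (rng k).
Proof.
rewrite /dalpha_arr /dalpha_ob => ek; case: ifP => // te.
have [_ er] := twisted_src te ek.
by rewrite rng_mul ?rng_mul //; exact: twisted_mul.
Qed.

Lemma dalpha_stab e k : sub_arr (estab e) k ->
  sub_arr (vstab (term e)) (dalpha_arr e k).
Proof.
move=> ek; have := ek; case=> f kf kf'; have mf := psecP kf.
rewrite /=/stab_arr/= dalpha_src // dalpha_rng // /dalpha_ob /dalpha_arr.
case: ifPn => te; last first.
  exists (if positive e then term f else orig f).
    exact: untwisted_sec.
  by rewrite -act_end //; exact: untwisted_sec.
have [es sE] := twisted_sec te kf; have [er rE] := twisted_sec te kf'.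
exists (vact A (dg e (src k)) (term f)) => //.
have c := twisted_mul te ek.
rewrite rE term_act // !act_mul ?es ?er //.
- rewrite -mulA ?src_inv // mulVg es -(src_mul er) mul_idr.
  by [].
- by rewrite src_mul ?src_inv ?es.
Qed.

Lemma dalpha_dom e x : sub_ob (estab e) x ->
  sub_ob (vstab (term e)) (dalpha_ob e x).
Proof.
move=> /sub_idm ex; rewrite -[x in dalpha_ob e x]src_idm -dalpha_src //.
exact: sub_src (dalpha_stab ex).
Qed.

Lemma dalpha_idm e x : sub_ob (estab e) x ->
  dalpha_arr e (idm x) = idm (dalpha_ob e x).
Proof.
move=> /sub_idm ex; rewrite /dalpha_arr /dalpha_ob; case: ifP => // te.
have [_] := twisted_src te ex; rewrite src_idm rng_idm => er.
by rewrite -[in idm x]er mul_idr mulgV.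
Qed.

Lemma dalpha_mul e k l : sub_arr (estab e) k -> sub_arr (estab e) l ->
  src k = rng l ->
  dalpha_arr e (mul k l) = mul (dalpha_arr e k) (dalpha_arr e l).
Proof.
rewrite /dalpha_arr => ek el kl; case: ifP => // te.
have [ks kr] := twisted_src te ek; have [ls lr] := twisted_src te el.
rewrite src_mul // rng_mul // kl.
set a := dg e (rng k) in kr *; set b := dg e (rng l) in lr *.
set c := dg e (src l) in ls *.
have ak : src (mul a k) = rng (inv b) by rewrite src_mul // rng_inv lr.
have bl : src (mul b l) = rng (inv c) by rewrite src_mul // rng_inv ls.
rewrite -[RHS]mulA //; last by rewrite rng_mul // src_inv rng_mul.
rewrite [mul (inv b) _]mulA //; last by rewrite src_inv rng_mul.
by rewrite [mul (inv b) _]mulA ?src_inv // mulVg lr mul_idl mulA ?mulA //;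
  rewrite ?src_mul ?rng_inv ?ls.
Qed.

Definition dalpha (e : edge Gam) : groupoid_hom (estab e) (vstab (term e)).
Proof.
refine (@GroupoidHom (estab e) (vstab (term e))
  (fun x => exist _ _ (dalpha_dom (proj2_sig x)))
  (fun k => exist _ _ (dalpha_stab (proj2_sig k))) _ _ _ _).
- by move=> k; apply: sig_eq; rewrite /= dalpha_src //; exact: proj2_sig.
- by move=> k; apply: sig_eq; rewrite /= dalpha_rng //; exact: proj2_sig.
- by move=> x; apply: sig_eq; rewrite /= dalpha_idm //; exact: proj2_sig.
- move=> k l kl; apply: sig_eq; rewrite [RHS]sg_mulE /=.
    rewrite (sg_mulE kl) dalpha_mul; try exact: proj2_sig.
      by [].
    exact: (congr1 (@proj1_sig _ _) kl).
  apply: sig_eq; rewrite /= dalpha_src ?dalpha_rng; try exact: proj2_sig.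
  by congr (dalpha_ob e _); exact: (congr1 (@proj1_sig _ _) kl).
Defined.

Lemma dalpha_inj e : injective (dalpha e).
Proof.
move=> [k ek] [l el] /(congr1 (@proj1_sig _ _)) /= kl; apply: sig_eq => /=.
move: kl ek el; rewrite /dalpha_arr; case: ifP => // /twistedP[pe nTe] kl.
rewrite /estab /pos_edge pe /= => ek el; exact: dg_inj pe nTe _ _ ek el kl.
Qed.

Definition desing_gog : graph_of_groupoids Gam :=
  GraphOfGroupoids (@dconnected D)
    (vgrp := fun v => groupoid_of_subgroupoid (vstab v))
    (egrp := fun e => groupoid_of_subgroupoid (estab e))
    (fun e => congr1 (fun f => groupoid_of_subgroupoid
       (Stab (eact A) (sige f))) (pos_edge_bar e))
    dalpha_inj.

End Desingularization.

(* Main.v *)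
From mathcomp Require Import all_boot.
From mathcomp Require Import boolp classical_sets.
From Stdlib Require Import Relation_Operators.
Require Import Defs.

(** The theorem is Bass-Serre theory in one direction: a groupoid that acts on a
    family of trees is recovered from the stabilizers of a fundamental domain.
    The proof compares G with pi_1 through the obvious morphism from pi_1 to G,
    which sends an element of a vertex groupoid to itself, the symbol of an edge
    e outside the maximal tree to g_(e,x) (or its inverse for the opposite edge)
    and the other symbols to units.  Its relations hold in G by construction, so
    what has to be shown is that this morphism is bijective.

    Wideness first removes all partiality.  The tree edges have the same domain
    as both of their ends and the root section is total, so every vertex section
    and then every edge section is defined on all of G^(0) ([sigv_total],
    [sige_total]), and the objects of pi_1 are the units of G.  Writing [twist e
    x] for g_(e,x) when e is a positive edge outside the tree and for the unit x
    otherwise makes the two ends of an edge play symmetric roles: [twist e x]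
    carries t(sigma_e(x)) into the section of t(e), and [twist (bar e) x]
    carries o(sigma_e(x)) into the section of o(e).

    An element c of pi_1 and a vertex v of Gamma determine the vertex
    proj(c).sigma_v of F, which depends only on the coset of c modulo the vertex
    groupoid; likewise for edges.  Cosets joined by an edge symbol give the two
    ends of an edge of F.  Two facts follow.
    - Every path of F that starts at a coset vertex lifts, step by step, to such
      a chain of cosets, because the saturations of the sections cover F
      ([path_lift]).  As the fibers are connected, the morphism is surjective
      ([proj_surj]).
    - If the path of F traced by a chain of cosets turns back on itself, then so
      does the chain: the two edges differ by an element of an edge stabilizer,
      and (R2) moves that element across the edge ([linked_backtrack]).  So
      every chain can be replaced by one with the same ends that traces a
      reduced path ([linked_reduced]).  If proj(c) is a unit, a chain from 1 to
      c traces a closed path; once reduced it is empty since the fiber is a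
      tree, so c lies in a vertex groupoid, on which the morphism is injective
      ([proj_inj]). *)

Set Implicit Arguments.
Unset Strict Implicit.
Unset Printing Implicit Defensive.

Local Open Scope classical_set_scope.
Local Open Scope quotient_scope.

(** * Calculus in a groupoid *)

(* The product is partial, so every rewriting with an axiom of groupoids leaves
   equations between sources and ranges.  [ends] computes them; [ends_step] is
   the hook through which later rules are added to it. *)
Ltac ends_step := fail.
Ltac ends := cbv beta; solve [
  repeat first
    [ match goal with
      | |- context [src (mul ?g ?h)] => rewrite (@src_mul _ g h); [|ends]
      | |- context [rng (mul ?g ?h)] => rewrite (@rng_mul _ g h); [|ends]
      end
    | progress rewrite ?src_inv ?rng_inv ?src_idm ?rng_idm ?hom_src ?hom_rng
    | progress ends_step ];
  congruence ].

Lemma mulKg (G : groupoid) (g h : arr G) : src g = rng h ->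
  mul (inv g) (mul g h) = h.
Proof. by move=> gh; rewrite mulA ?mulVg ?gh ?mul_idl //; ends. Qed.

Lemma mulgK (G : groupoid) (g h : arr G) : src g = rng h ->
  mul (mul g h) (inv h) = g.
Proof. by move=> gh; rewrite -mulA ?mulgV -?gh ?mul_idr //; ends. Qed.

Lemma mulgKV (G : groupoid) (g h : arr G) : src g = src h ->
  mul (mul g (inv h)) h = g.
Proof. by move=> gh; rewrite -mulA ?mulVg -?gh ?mul_idr //; ends. Qed.

Lemma mulKVg (G : groupoid) (g h : arr G) : rng g = rng h ->
  mul g (mul (inv g) h) = h.
Proof. by move=> gh; rewrite mulA ?mulgV ?gh ?mul_idl //; ends. Qed.

Lemma inv_uniq (G : groupoid) (g h : arr G) : src g = rng h ->
  mul g h = idm (src h) -> g = inv h.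
Proof. by move=> gh e; rewrite -(mulgK gh) e -(rng_inv h) mul_idl. Qed.

Lemma invK (G : groupoid) (g : arr G) : inv (inv g) = g.
Proof. by apply/esym/inv_uniq; rewrite ?mulgV ?src_inv ?rng_inv. Qed.

Lemma invM (G : groupoid) (g h : arr G) : src g = rng h ->
  inv (mul g h) = mul (inv h) (inv g).
Proof.
move=> gh; apply/esym/inv_uniq; first by ends.
by rewrite -mulA; [rewrite mulKg // mulVg; congr idm; ends|ends|ends].
Qed.

Lemma inv_idm (G : groupoid) (x : ob G) : inv (idm x) = idm x.
Proof.
apply/esym/inv_uniq; first by ends.
by have := mul_idl (idm x); rewrite rng_idm src_idm.
Qed.

Lemma hom_inv (G H : groupoid) (f : groupoid_hom G H) g :
  f (inv g) = inv (f g).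
Proof.
apply: inv_uniq; first by ends.
by rewrite -hom_mul ?mulVg ?hom_idm ?hom_src //; ends.
Qed.

Lemma isomorphic_of_bij (G H : groupoid) (f : groupoid_hom H G)
    (u : ob G -> ob H) :
  cancel (hom_ob f) u -> cancel u (hom_ob f) -> injective f ->
  (forall g, exists h, f h = g) -> isomorphic G H.
Proof.
move=> fu uf injf surf.
have [s sK] := choice surf.
have s_src g : src (s g) = u (src g) by rewrite -(fu (src (s g))) -hom_src sK.
have s_rng g : rng (s g) = u (rng g) by rewrite -(fu (rng (s g))) -hom_rng sK.
have s_idm x : s (idm x) = idm (u x) by apply: injf; rewrite sK hom_idm uf.
have s_mul g h : src g = rng h -> s (mul g h) = mul (s g) (s h).
  by move=> gh; apply: injf; rewrite hom_mul ?sK // s_src s_rng gh.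
exists (GroupoidHom s_src s_rng s_idm s_mul), f; split=> //= h.
by apply: injf; rewrite sK.
Qed.

(** * Groupoids given by generators and relations *)

Section PresentedMorphisms.
Variables (X gen : Type) (grng gsrc : gen -> X).
Variable rel : seq (letter gen) -> seq (letter gen) -> Prop.
Notation chain := (chain grng gsrc).
Notation word := (word grng gsrc).
Notation lrng := (lrng grng gsrc).
Notation lsrc := (lsrc grng gsrc).
Notation P := (presented_groupoid grng gsrc rel).

Lemma chain_fun y l x x' : chain y l x -> chain y l x' -> x = x'.
Proof. by elim: l y => [y <-|a l IHl y [_ c] [_ /(IHl _ c)]]. Qed.

Lemma chain_inj y y' l x : chain y l x -> chain y' l x -> y = y'.
Proof. by case: l => [->|a l [<- _] [<- _]]. Qed.

Lemma chain_split y l l' x : chain y (l ++ l') x ->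
  exists2 m, chain y l m & chain m l' x.
Proof.
elim: l y => [y c|a l IHl y [ay /IHl[m lm mx]]]; first by exists y.
by exists m.
Qed.

Section Universal.
Variables (H : groupoid) (fo : X -> ob H) (fg : gen -> arr H).
Hypothesis fg_src : forall a, src (fg a) = fo (gsrc a).
Hypothesis fg_rng : forall a, rng (fg a) = fo (grng a).

Definition leval (a : letter gen) : arr H :=
  if a.2 then fg a.1 else inv (fg a.1).

Definition eval (x : X) (l : seq (letter gen)) : arr H :=
  foldr (fun a h => mul (leval a) h) (idm (fo x)) l.

Lemma leval_src a : src (leval a) = fo (lsrc a).
Proof. by case: a => a []; rewrite /leval /Defs.lsrc /= ?src_inv. Qed.

Lemma leval_rng a : rng (leval a) = fo (lrng a).
Proof. by case: a => a []; rewrite /leval /Defs.lrng /= ?rng_inv. Qed.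

Lemma leval_inv a : leval (linv a) = inv (leval a).
Proof. by case: a => a []; rewrite /leval /= ?invK. Qed.

Lemma eval_ends y l x : chain y l x ->
  src (eval x l) = fo x /\ rng (eval x l) = fo y.
Proof.
elim: l y => [y ->|a l IHl y [<- /IHl[sl rl]]] /=.
  by rewrite src_idm rng_idm.
by rewrite src_mul ?rng_mul ?leval_src ?leval_rng.
Qed.

Lemma eval_cat y l m l' x : chain y l m -> chain m l' x ->
  eval x (l ++ l') = mul (eval m l) (eval x l').
Proof.
move=> + c'; have [_ rl'] := eval_ends c'.
elim: l y => [y _|a l IHl y [_ c]] /=; first by rewrite -rl' mul_idl.
have [sl rl] := eval_ends c.
by rewrite (IHl _ c) mulA ?leval_src ?sl ?rl.
Qed.

Hypothesis eval_rel : forall l l' y x, rel l l' -> chain y l x ->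
  chain y l' x -> eval x l = eval x l'.

Lemma eval_elementary l l' y x : elementary rel l l' -> chain y l x ->
  chain y l' x -> eval x l = eval x l'.
Proof.
case=> {l l'} [l l'|a]; first exact: eval_rel.
move=> [ay [_ <-]] _; rewrite /= leval_inv mulA.
- rewrite mulgV leval_rng lsrc_inv.
  by have := mul_idl (idm (fo (lrng a))); rewrite rng_idm.
- by rewrite rng_inv.
- by rewrite src_inv leval_rng rng_idm lsrc_inv.
Qed.

(** In a step u l v = u l' v the words l and l' are chains between the same two
    objects, since u determines its source end and v its range end; this is why
    [eval_rel] may assume both chains. *)
Lemma eval_weq (w w' : word) : weq rel w w' ->
  eval (wsrc w) (wseq w) = eval (wsrc w') (wseq w').
Proof.
elim=> {w w'} [w w' []|//|w w' _ ->//|w1 w2 w3 _ -> _ ->//].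
case: w w' => y l x c [y' l' x' c'] /= yy' xx' [l1 [l3 [l2 [l2' [el e e']]]]].
subst; have [m c1 {}c] := chain_split c; have [n c2 c3] := chain_split c.
have [m' c1' {}c'] := chain_split c'; have [n' c2' c3'] := chain_split c'.
have mm := chain_fun c1 c1'; have nn := chain_inj c3 c3'; subst.
rewrite (eval_cat c1 c) (eval_cat c1' c') (eval_cat c2 c3) (eval_cat c2' c3').
by rewrite (eval_elementary el c2 c2').
Qed.

Definition pres_arr (g : warr grng gsrc rel) : arr H :=
  eval (wsrc (repr g)) (wseq (repr g)).

Lemma pres_arr_pi (w : word) :
  pres_arr (\pi_(warr grng gsrc rel) w) = eval (wsrc w) (wseq w).
Proof. by apply/esym/eval_weq; exact: weq_repr. Qed.

(** The universal property of the presented groupoid. *)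
Definition pres_hom : groupoid_hom P H.
Proof.
refine (@GroupoidHom P H fo pres_arr _ _ _ _).
- by move=> g; have [] := eval_ends (wchain (repr g)).
- by move=> g; have [] := eval_ends (wchain (repr g)).
- by move=> x; rewrite pres_arr_pi.
- move=> g h e.
  have e' : wsrc (repr g) = wrng (repr h) := e; have [r s q] := wcatE e'.
  rewrite pres_arr_pi s q; apply: eval_cat (wchain (repr g)) _.
  by rewrite e'; exact: wchain.
Defined.

End Universal.

Definition lword (a : letter gen) : word :=
  @Word _ _ grng gsrc (lrng a) [:: a] (lsrc a) (conj erefl erefl).

Definition larr (a : letter gen) : arr P := \pi_(warr grng gsrc rel) (lword a).

Definition lprod (x : X) (l : seq (letter gen)) : arr P :=
  foldr (fun a g => mul (larr a) g) (idm (x : ob P)) l.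

Lemma larr_src a : src (larr a) = lsrc a :> ob P.
Proof. exact: parr_src_pi. Qed.

Lemma larr_rng a : rng (larr a) = lrng a :> ob P.
Proof. exact: parr_rng_pi. Qed.

(** The evaluation of a word in the presented groupoid itself is its class, so
    the relations can be used there as equations between products. *)
Lemma lprod_pi (w : word) :
  \pi_(warr grng gsrc rel) w = lprod (wsrc w) (wseq w).
Proof.
case: w => y l x; elim: l y => [y /= e|a l IHl y /= c].
  by subst; congr (\pi_ _ _); exact: word_eq.
have [ay c'] := c; subst; rewrite -(IHl _ c').
have e : wsrc (lword a) = wrng (Word c') by [].
rewrite [RHS](parr_mul_pi rel e); congr (\pi_ _ _).
by have [r s q] := wcatE e; apply: word_eq.
Qed.

Lemma pres_hom_larr H fo fg fs fr Hr (a : letter gen) :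
  @pres_hom H fo fg fs fr Hr (larr a) = leval fg a.
Proof.
rewrite /= pres_arr_pi //=.
by have := mul_idr (leval fg a); rewrite (leval_src fs fr).
Qed.

Lemma presented_ind (Q : arr P -> Prop) :
  (forall x : ob P, Q (idm x)) ->
  (forall a (g : arr P), lsrc a = rng g :> ob P -> Q g -> Q (mul (larr a) g)) ->
  forall g, Q g.
Proof.
move=> Q0 QS g; rewrite -[g]reprK lprod_pi.
case: (repr g) => y l x /=; elim: l y => [y _|a l IHl y [_ c]]; first exact: Q0.
apply: (QS a (lprod x l)); last exact: IHl c.
by rewrite -(lprod_pi (Word c)); apply/esym; exact: parr_rng_pi.
Qed.

Lemma lprod_rel l l' y x : rel l l' -> chain y l x -> chain y l' x ->
  lprod x l = lprod x l'.
Proof.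
move=> ll' c c'; rewrite -(lprod_pi (Word c)) -(lprod_pi (Word c')).
apply/weqP/rst_step; split=> //=; exists [::], [::], l, l'.
by rewrite !cats0; split=> //; exact: elem_rel.
Qed.

Lemma lprod1 a : lprod (lsrc a) [:: a] = larr a.
Proof. by have := mul_idr (larr a); rewrite larr_src. Qed.

Lemma larr_inv a : larr (linv a) = inv (larr a).
Proof.
apply/esym; rewrite -[RHS]invK; congr inv; apply: inv_uniq.
  by rewrite larr_src larr_rng lrng_inv.
have c : chain (lrng a) [:: a; linv a] (lrng a).
  by rewrite /= lrng_inv lsrc_inv.
have s : src (larr (linv a)) = lrng a :> ob P by rewrite larr_src lsrc_inv.
have m : mul (larr a) (larr (linv a)) = lprod (lrng a) [:: a; linv a].
  by rewrite -[X in mul _ X]lprod1 lsrc_inv.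
rewrite m s -(lprod_pi (Word c)); apply/weqP/rst_step.
split=> //=; exists [::], [::], [:: a; linv a], [::].
by split=> //; exact: elem_inv.
Qed.

End PresentedMorphisms.

(** * Total sections of a wide desingularization *)

(** [act_mom] with the momentum of an edge in beta-reduced form, as needed for
    rewriting. *)
Lemma eact_mom (G : groupoid) (F : graph) (A : graph_action G F) g f :
  src g = mom A (term f) -> mom A (term (eact A g f)) = rng g.
Proof. exact: (act_mom (eact A)). Qed.

Section WideDesingularization.
Variables (G : groupoid) (F : graph) (A : graph_action G F).
Hypothesis fiber_tree : forall x : ob G, is_tree (fiber A x).

(** Otherwise [e; bar f] would be a reduced closed path in a fiber. *)
Lemma edge_ends_inj (e f : edge F) :
  orig e = orig f -> term e = term f -> e = f.
Proof.
move=> oef tef; have /is_treeP[_ tF] := fiber_tree (mom A (term e)).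
apply: contrapT => nef.
suff : [:: e; bar f] = [::] by [].
apply: (tF (term e)) => //=.
- by do 2!split=> //; rewrite term_bar -oef mom_edge.
- by rewrite term_bar orig_bar.
- by split=> // /(congr1 (@bar F)); rewrite !barK => /esym.
Qed.

(** The action respects inversion of edges because in a tree an edge is
    determined by its ends. *)
Lemma eact_bar g f : src g = mom A (term f) ->
  eact A g (bar f) = bar (eact A g f).
Proof.
move=> gf; have gf' : src g = mom A (term (bar f)) by rewrite term_bar mom_edge.
apply: edge_ends_inj.
- by rewrite orig_act // !orig_bar term_act.
- by rewrite term_act // !term_bar orig_act.
Qed.

Variables (D : desingularization A) (wideD : wide (desing_gog D)).
Notation Gam := (dgraph D).
Notation Tr := (dtree D).

Lemma sige_dom_bar e x : pdom (sige (bar e)) x = pdom (@sige _ _ _ D e) x.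
Proof. by rewrite /pdom /= sige_bar; case: (sige e x). Qed.

Lemma sige_dom_pos e x : pdom (sige (pos_edge e)) x = pdom (@sige _ _ _ D e) x.
Proof. by rewrite /pos_edge; case: ifP => // _; rewrite sige_dom_bar. Qed.

(** When alpha_e is an inclusion, the unit of G_e above a given unit x of
    G_(t(e)) can only be x. *)
Lemma sige_dom_wide (e : edge Gam) x : ~~ twisted e ->
  pdom (sigv (term e)) x -> pdom (sige e) x.
Proof.
move=> nte tx; have [[k ek] kE] := wideD (e := e) (exist _ x tx).
have := congr1 (fun l : sg_arr (vstab (term e)) => src (proj1_sig l)) kE.
rewrite /= src_idm /dalpha_arr (negPf nte) => <-.
by rewrite -sige_dom_pos; exact: (sub_src ek).
Qed.

Lemma untwisted_or (e : edge Gam) : ~~ twisted e \/ ~~ twisted (bar e).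
Proof. by rewrite /twisted positive_bar; case: positive; [right|left]. Qed.

Lemma tree_untwisted (e : edge Gam) : sub_edge Tr e -> ~~ twisted e.
Proof. by move=> Te; apply/twistedP => -[]. Qed.

(** Induction along the path of the maximal tree from the root, whose section is
    total: each tree edge passes totality from its origin to its terminus. *)
Lemma sigv_total v x : exists w, sigv (v : vert Gam) x = Some w.
Proof.
suff : pdom (sigv v) x.
  by rewrite /pdom /=; case: (sigv v x) => // w _; exists w.
have [/is_treeP[cT _] _] := rmt_max Tr.
have sT := maximal_subtree_spanning Tr (@dconnected _ _ _ D).
have [p Tp vp] := cT (root Tr) v (sT _) (sT v).
elim: p v Tp vp => [v _ <-|e p IHp v [Te Tp] [<- vp]].
  by rewrite sigv_root.
have ox := IHp _ Tp vp; have nbe := tree_untwisted (sub_bar Te).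
have : pdom (sige (bar e)) x by apply: sige_dom_wide; rewrite ?term_bar.
rewrite sige_dom_bar /pdom /=; case ex: (sige e x) => [f|//] _.
by rewrite (tree_term Te ex).
Qed.

Lemma sige_total e x : exists f, sige (e : edge Gam) x = Some f.
Proof.
suff : pdom (sige e) x.
  by rewrite /pdom /=; case: (sige e x) => // f _; exists f.
have dom v : pdom (@sigv _ _ _ D v) x.
  by have [w wE] := sigv_total v x; rewrite /pdom /= wE.
have [nt|nt] := untwisted_or e; first exact: sige_dom_wide.
by rewrite -sige_dom_bar; exact: sige_dom_wide.
Qed.

Definition vsec v x : vert F := projT1 (cid (sigv_total v x)).
Definition esec e x : edge F := projT1 (cid (sige_total e x)).
Definition twist (e : edge Gam) x : arr G :=
  if twisted e then dg e x else idm x.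

Lemma vsecE v x : sigv v x = Some (vsec v x).
Proof. by rewrite /vsec; case: cid. Qed.

Lemma esecE e x : sige e x = Some (esec e x).
Proof. by rewrite /esec; case: cid. Qed.

Lemma vsec_mom v x : mom A (vsec v x) = x. Proof. exact: psecP (vsecE v x). Qed.

Lemma esec_mom e x : mom A (term (esec e x)) = x.
Proof. exact: psecP (esecE e x). Qed.

Lemma esec_bar e x : esec (bar e) x = bar (esec e x).
Proof. by have := sige_bar e x; rewrite !esecE => -[]. Qed.

Lemma esec_momo e x : mom A (orig (esec e x)) = x.
Proof. by rewrite -term_bar -esec_bar esec_mom. Qed.

Lemma esec_pos e x : sige (pos_edge e) x =
  Some (if positive e then esec e x else bar (esec e x)).
Proof. by rewrite esecE /pos_edge; case: ifP => //; rewrite esec_bar. Qed.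

Lemma twist_src e x : src (twist e x) = x.
Proof.
rewrite /twist; case: ifP => [te|_]; last by rewrite src_idm.
by have [] := twisted_sec te (esec_pos e x).
Qed.

(** This holds for all edges of Gamma and, applied to [bar e], describes the
    origin of sigma_e(x) too; see [twist_orig]. *)
Lemma twist_term e x :
  vact A (twist e x) (term (esec e x)) = vsec (term e) (rng (twist e x)).
Proof.
rewrite /twist; case: ifP => [te|/negbT nte].
  have [_] := twisted_sec te (esec_pos e x); rewrite vsecE => -[->].
  by have [pe _] := twistedP _ te; rewrite pe.
rewrite rng_idm -{1}(esec_mom e x) act_idm.
have := untwisted_sec nte (esec_pos e x); rewrite vsecE => -[->].
by case: positive; rewrite ?orig_bar.
Qed.

Lemma vsec_disjoint g h v v' :
  vact A g (vsec v (src g)) = vact A h (vsec v' (src h)) -> v = v'.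
Proof.
move=> e; have := @sigv_disjoint _ _ _ D v v' I I; apply.
exists (vact A g (vsec v (src g))); split.
- exists (vsec v (src g)); first by exists (src g); rewrite vsecE.
  by exists g; rewrite ?vsec_mom.
- exists (vsec v' (src h)); first by exists (src h); rewrite vsecE.
  by exists h; rewrite ?vsec_mom.
Qed.

Lemma esec_disjoint g h e e' :
  eact A g (esec e (src g)) = eact A h (esec e' (src h)) -> e = e'.
Proof.
move=> eE; have := @sige_disjoint _ _ _ D e e' I I; apply.
exists (eact A g (esec e (src g))); split.
- exists (esec e (src g)); first by exists (src g); rewrite esecE.
  by exists g; rewrite ?esec_mom.
- exists (esec e' (src h)); first by exists (src h); rewrite esecE.
  by exists h; rewrite ?esec_mom.
Qed.

Lemma esec_cover f : exists e g, f = eact A g (esec e (src g)).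
Proof.
have : [set: edge F] f by []; rewrite -(sige_cover D) => -[e _].
case=> f' [x]; rewrite esecE => -[<-] [g]; rewrite esec_mom => gx <-.
by exists e, g; rewrite gx.
Qed.

(** Membership in the stabilizers of the sections, as an equation: the sections
    being total, the conditions on domains disappear. *)
Definition vfix (v : vert Gam) (k : arr G) : Prop :=
  vsec v (rng k) = vact A k (vsec v (src k)).

Definition efix (e : edge Gam) (k : arr G) : Prop :=
  esec e (rng k) = eact A k (esec e (src k)).

Lemma vfixP v k : vfix v k <-> sub_arr (vstab v) k.
Proof.
split=> [e|[y]]; first by exists (vsec v (src k)); rewrite ?vsecE // e.
by rewrite /vfix !vsecE => -[<-] [].
Qed.

Lemma efix_bar e k : efix e k -> efix (bar e) k.
Proof. by rewrite /efix !esec_bar => ->; rewrite eact_bar ?esec_mom. Qed.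

Lemma efixP e k : efix e k <-> sub_arr (estab e) k.
Proof.
suff sE f : efix f k <-> stab_arr (eact A) (sige f) k.
  rewrite /= -sE /pos_edge; case: ifP => // _; split; first exact: efix_bar.
  by move=> /efix_bar; rewrite barK.
split=> [e'|[y]]; first by exists (esec f (src k)); rewrite ?esecE // e'.
by rewrite /efix !esecE => -[<-] [].
Qed.

(** A formula for alpha_e valid on all edges, see [dalpha_arrE]. *)
Definition ealpha e (k : arr G) : arr G :=
  mul (mul (twist e (rng k)) k) (inv (twist e (src k))).

Lemma dalpha_arrE e k : dalpha_arr e k = ealpha e k.
Proof.
rewrite /dalpha_arr /ealpha /twist; case: ifP => // _.
have -> : inv (idm (src k)) = idm (src k) by rewrite inv_idm.
by rewrite mul_idl mul_idr.
Qed.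

Lemma dalpha_obE e x : dalpha_ob e x = rng (twist e x).
Proof. by rewrite /dalpha_ob /twist; case: ifP => //; rewrite rng_idm. Qed.

Lemma ealpha_composable e k :
  src (mul (twist e (rng k)) k) = rng (inv (twist e (src k))).
Proof. by rewrite rng_inv src_mul ?twist_src. Qed.

Lemma ealpha_src e k : src (ealpha e k) = rng (twist e (src k)).
Proof. by rewrite /ealpha (src_mul (ealpha_composable e k)) src_inv. Qed.

Lemma ealpha_rng e k : rng (ealpha e k) = rng (twist e (rng k)).
Proof.
by rewrite /ealpha (rng_mul (ealpha_composable e k)) rng_mul ?twist_src.
Qed.

Lemma vfix_ealpha e k : efix e k -> vfix (term e) (ealpha e k).
Proof. by move=> /efixP /dalpha_stab; rewrite dalpha_arrE => /vfixP. Qed.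


(** * Chains of cosets and paths in the forest *)

(** What the argument uses of pi_1 and of its morphism to G.  The maps
    [cov_vert] and [cov_edge] have plain arrows and objects of G as arguments
    and so do not carry the dependent types of the generators; in particular
    v can be rewritten by [bar (bar e) = e] and the like.  The symbol
    [cov_edge e x] is the one above sigma_e(x), hence its ends are the [twist]s
    of x rather than x. *)
Record cover := Cover {
  cov :> groupoid;
  cov_proj : groupoid_hom cov G;
  cov_ob : ob G -> ob cov;
  cov_obK : cancel cov_ob (hom_ob cov_proj);
  cov_projK : cancel (hom_ob cov_proj) cov_ob;
  cov_vert : vert Gam -> arr G -> arr cov;
  cov_vert_src : forall v k, vfix v k -> src (cov_vert v k) = cov_ob (src k);
  cov_vert_rng : forall v k, vfix v k -> rng (cov_vert v k) = cov_ob (rng k);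
  cov_vert_idm : forall v x, cov_vert v (idm x) = idm (cov_ob x);
  cov_vert_mul : forall v k l, vfix v k -> vfix v l -> src k = rng l ->
    cov_vert v (mul k l) = mul (cov_vert v k) (cov_vert v l);
  cov_vert_proj : forall v k, vfix v k -> cov_proj (cov_vert v k) = k;
  cov_edge : edge Gam -> ob G -> arr cov;
  cov_edge_src : forall e x,
    src (cov_edge e x) = cov_ob (rng (twist (bar e) x));
  cov_edge_rng : forall e x, rng (cov_edge e x) = cov_ob (rng (twist e x));
  cov_edge_bar : forall e x, cov_edge (bar e) x = inv (cov_edge e x);
  cov_edge_tree : forall e x, sub_edge Tr e -> cov_edge e x = idm (cov_ob x);
  cov_edge_proj : forall e x,
    cov_proj (cov_edge e x) = mul (twist e x) (inv (twist (bar e) x));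
  cov_edge_ealpha : forall e k, efix e k ->
    mul (cov_edge e (rng k)) (cov_vert (term (bar e)) (ealpha (bar e) k)) =
    mul (cov_vert (term e) (ealpha e k)) (cov_edge e (src k));
  cov_ind : forall Q : arr cov -> Prop,
    (forall x, Q (idm (cov_ob x))) ->
    (forall v k c, vfix v k -> cov_ob (src k) = rng c -> Q c ->
       Q (mul (cov_vert v k) c)) ->
    (forall e x c, cov_ob (rng (twist (bar e) x)) = rng c -> Q c ->
       Q (mul (cov_edge e x) c)) ->
    forall c, Q c
}.

Section BassSerre.
Variable L : cover.
Notation proj := (cov_proj L).
Notation u := (@cov_ob L).
Notation V := (@cov_vert L).
Notation E := (@cov_edge L).

Ltac ends_step ::= first
  [ progress rewrite ?cov_edge_src ?cov_edge_rng ?twist_src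
      ?(barK, vsec_mom, esec_mom, esec_momo, cov_obK)
  | match goal with
    | |- context [mom A (act (vact A) ?g ?y)] =>
        rewrite (act_mom (vact A) (g:=g) (y:=y)); [|ends]
    | |- context [mom A (term (act (eact A) ?g ?y))] =>
        rewrite (@eact_mom _ _ A g y); [|ends]
    | H : src ?c = _ |- context [src ?c] => rewrite H
    | H : vfix ?v ?k |- context [src (@cov_vert _ ?v ?k)] =>
        rewrite (cov_vert_src _ H)
    | H : vfix ?v ?k |- context [rng (@cov_vert _ ?v ?k)] =>
        rewrite (cov_vert_rng _ H)
    end ].

Lemma vfix_mul v k l :
  vfix v k -> vfix v l -> src k = rng l -> vfix v (mul k l).
Proof. by move=> /vfixP vk /vfixP vl kl; apply/vfixP; exact: stab_mul. Qed.

Lemma vfix_idm v x : vfix v (idm x).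
Proof.
by rewrite /vfix rng_idm src_idm -{2}(vsec_mom v x) act_idm.
Qed.

Definition coset_vertex v (c : arr L) : vert F :=
  vact A (proj c) (vsec v (src (proj c))).

Lemma coset_vertex_mom v c : mom A (coset_vertex v c) = rng (proj c).
Proof. by rewrite /coset_vertex; ends. Qed.

(** The vertex groupoid fixes the section, so [coset_vertex] is a function of
    the coset of c modulo that groupoid. *)
Lemma coset_vertex_mul v c k : vfix v k -> src c = u (rng k) ->
  coset_vertex v (mul c (V v k)) = coset_vertex v c.
Proof.
move=> vk ck; rewrite /coset_vertex hom_mul; last by ends.
rewrite (cov_vert_proj L vk) src_mul; last by ends.
rewrite -act_mul; [|ends|ends].
by rewrite -vk hom_src ck cov_obK.
Qed.

Lemma twist_orig e x :
  vact A (twist (bar e) x) (orig (esec e x)) =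
  vsec (term (bar e)) (rng (twist (bar e) x)).
Proof. by rewrite -term_bar -esec_bar twist_term. Qed.

(** The edge of F from the vertex of the coset of c at [term (bar e)] to that of
    the coset reached through the symbol of e. *)
Definition coset_edge e x (c : arr L) : edge F :=
  eact A (mul (proj c) (twist (bar e) x)) (esec e x).

Lemma coset_edge_mom e x c : src c = u (rng (twist (bar e) x)) ->
  mom A (term (coset_edge e x c)) = rng (proj c).
Proof. by move=> cx; rewrite /coset_edge; ends. Qed.

Lemma coset_edge_orig e x c : src c = u (rng (twist (bar e) x)) ->
  orig (coset_edge e x c) = coset_vertex (term (bar e)) c.
Proof.
move=> cx; rewrite /coset_edge orig_act; last by ends.
rewrite -act_mul; [|ends|ends].
by rewrite twist_orig /coset_vertex hom_src cx cov_obK.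
Qed.

Lemma coset_edge_term e x c : src c = u (rng (twist (bar e) x)) ->
  term (coset_edge e x c) = coset_vertex (term e) (mul c (E (bar e) x)).
Proof.
move=> cx; rewrite /coset_edge term_act; last by ends.
rewrite /coset_vertex hom_mul; last by ends.
rewrite cov_edge_proj barK.
have -> : src (mul (proj c) (mul (twist (bar e) x) (inv (twist e x)))) =
    rng (twist e x).
  by ends.
rewrite -twist_term act_mul; [|ends|ends].
congr (act _ _ _); rewrite -mulA; [|ends|ends]; congr mul.
by rewrite mulgKV //; ends.
Qed.

(** [linked v0 c0 p v c]: the coset of c at v is reached from that of c0 at v0
    by a chain of cosets that traces the path p of F.  The endpoint is a
    representative, which [linked_vert] changes inside its coset without
    changing the path. *)
Inductive linked (v0 : vert Gam) (c0 : arr L) :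
    seq (edge F) -> vert Gam -> arr L -> Prop :=
| linked_refl : linked v0 c0 [::] v0 c0
| linked_vert p v c k : linked v0 c0 p v c -> vfix v k -> src c = u (rng k) ->
    linked v0 c0 p v (mul c (V v k))
| linked_edge p e c x : linked v0 c0 p (term (bar e)) c ->
    src c = u (rng (twist (bar e) x)) ->
    linked v0 c0 (coset_edge e x c :: p) (term e) (mul c (E (bar e) x)).

Lemma linked_rng v0 c0 p v c : linked v0 c0 p v c -> rng c = rng c0.
Proof. by elim=> {p v c} // [p v c k _ IH vk ck|p e c x _ IH cx]; ends. Qed.

Lemma linked_path v0 c0 p v c :
  linked v0 c0 p v c -> is_path (coset_vertex v0 c0) p (coset_vertex v c).
Proof.
elim=> {p v c} // [p v c k _ IH vk ck|p e c x _ IH cx].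
  by rewrite coset_vertex_mul.
by rewrite /= coset_edge_term // coset_edge_orig.
Qed.

Lemma linked_fiber v0 c0 p v c : linked v0 c0 p v c ->
  path_in (fiber A (rng (proj c0))) p.
Proof.
elim=> {p v c} // p e c x /linked_rng cc0 IH cx; split=> //.
by rewrite /= coset_edge_mom // !hom_rng cc0.
Qed.

Lemma cov_ob_inj : injective u. Proof. exact: can_inj (@cov_obK L). Qed.

Lemma mul_vert v c k l : vfix v k -> vfix v l -> src c = u (rng k) ->
  src k = rng l -> mul (mul c (V v k)) (V v l) = mul c (V v (mul k l)).
Proof. by move=> vk vl ck kl; rewrite cov_vert_mul // mulA //; ends. Qed.

Lemma mul_vert_idm v (c : arr L) :
  mul c (V v (idm (hom_ob proj (src c)))) = c.
Proof. by rewrite cov_vert_idm cov_projK mul_idr. Qed.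

Lemma linked_nilP v0 c0 p v c : linked v0 c0 p v c -> p = [::] ->
  exists k, [/\ v = v0, vfix v k, src c0 = u (rng k) & c = mul c0 (V v k)].
Proof.
elim=> {p v c} // [_|p v c l _ IH vl cl /IH[k [vE vk ck cE]]].
  exists (idm (hom_ob proj (src c0))); split; rewrite ?mul_vert_idm //.
    exact: vfix_idm.
  by rewrite rng_idm cov_projK.
have kl : src k = rng l by apply: cov_ob_inj; rewrite -cl cE; ends.
exists (mul k l); split=> //; first exact: vfix_mul.
  by ends.
by rewrite cE mul_vert.
Qed.

Lemma linked_consP v0 c0 p v c f q : linked v0 c0 p v c -> p = f :: q ->
  exists e d x k, [/\ v = term e, linked v0 c0 q (term (bar e)) d,
    src d = u (rng (twist (bar e) x)) /\ f = coset_edge e x d,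
    vfix v k /\ rng k = rng (twist e x) &
    c = mul (mul d (E (bar e) x)) (V v k)].
Proof.
elim=> {p v c} // [p v c l _ IH vl cl /IH|p e c x pc _ cx [<- <-]].
  move=> [e [d [x [k [vE qd [dx fE] [vk kx] cE]]]]].
  have kl : src k = rng l by apply: cov_ob_inj; rewrite -cl cE; ends.
  exists e, d, x, (mul k l); split=> //.
    by split; [exact: vfix_mul|ends].
  by rewrite cE mul_vert //; ends.
exists e, c, x, (idm (rng (twist e x))); split=> //.
  by split; [exact: vfix_idm|rewrite rng_idm].
have -> : rng (twist e x) = hom_ob proj (src (mul c (E (bar e) x))) by ends.
by rewrite mul_vert_idm.
Qed.

Lemma conj_cancel (a b b' k g : arr G) : src a = rng b -> src b = src b' ->
  rng b' = rng k -> src k = rng g ->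
  mul (mul b' (mul (inv (mul a b)) (mul (mul (mul a (mul b (inv b'))) k) g)))
    (inv g) = k.
Proof.
move=> ab bb bk kg.
have -> : mul (mul (mul a (mul b (inv b'))) k) g =
    mul (mul a b) (mul (inv b') (mul k g)).
  by rewrite !mulA //; ends.
rewrite mulKg; last by ends.
by rewrite mulKVg ?mulgK //; ends.
Qed.

(** The heart of injectivity.  If the chain arrives at c by the edge opposite to
    the one by which it is about to leave, the previous coset is the coset it
    would go to.  Indeed the next edge and the previous one reversed are
    translates of values of the same section sigma_e, so that the two
    translations differ by an element m of its stabilizer, and (R2) for m
    identifies the two cosets. *)
Lemma linked_backtrack v0 c0 p q e x c : linked v0 c0 p (term (bar e)) c ->
  src c = u (rng (twist (bar e) x)) -> p = bar (coset_edge e x c) :: q ->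
  linked v0 c0 q (term e) (mul c (E (bar e) x)).
Proof.
move=> pc cx pE.
have [e' [d [x' [k [_ qd [dx' fE] [vk kx'] cE]]]]] := linked_consP pc pE.
have hc : src (mul (proj c) (twist (bar e) x)) = x by ends.
have barf : bar (coset_edge e x c) =
    eact A (mul (proj c) (twist (bar e) x)) (esec (bar e) x).
  by rewrite esec_bar // eact_bar //; ends.
have hd : src (mul (proj d) (twist (bar e') x')) = x' by ends.
(* The saturations of the edge sections are disjoint. *)
have ee' : bar e = e'.
  apply: (@esec_disjoint (mul (proj c) (twist (bar e) x))
    (mul (proj d) (twist (bar e') x'))).
  by rewrite hc hd -barf fE.
move: ee' qd dx' fE kx' cE hd => <- {e'}; rewrite !barK.
move=> qd dx' fE kx' cE hd.
pose m := mul (inv (mul (proj d) (twist e x')))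
  (mul (proj c) (twist (bar e) x)).
have kg : src k = rng (twist (bar e) x).
  by apply: cov_ob_inj; rewrite -cx cE; ends.
have rcd : rng c = rng d by rewrite cE; ends.
have mE : efix e m.
  rewrite -[e]barK; apply: efix_bar; rewrite /efix /m.
  rewrite -act_mul; [|ends|ends].
  have -> : src (mul (inv (mul (proj d) (twist e x')))
    (mul (proj c) (twist (bar e) x))) = x by ends.
  rewrite -barf fE /coset_edge barK act_mul; [|ends|ends].
  rewrite mulVg hd.
  have /= := act_idm (eact A) (esec (bar e) x'); rewrite esec_mom => ->.
  by congr (esec _ _); ends.
have ms : src m = x by rewrite /m; ends.
have mr : rng m = x' by rewrite /m; ends.
(* The correction k made inside the vertex groupoid is forced by the images in
   G, and is the image of m. *)
have k_ealpha : ealpha (bar e) m = k.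
  rewrite /ealpha ms mr /m.
  have -> : proj c =
      mul (mul (proj d) (mul (twist e x') (inv (twist (bar e) x')))) k.
    rewrite cE !hom_mul; [|ends|ends].
    by rewrite cov_edge_proj cov_vert_proj.
  by apply: conj_cancel; ends.
have em := vfix_ealpha mE.
have me : src (ealpha e m) = rng (twist e x) by rewrite /ealpha; ends.
have re : rng (ealpha e m) = rng (twist e x') by rewrite /ealpha; ends.
suff -> : mul c (E (bar e) x) = mul d (V (term e) (ealpha e m)).
  by apply: linked_vert => //; rewrite re.
have := cov_edge_ealpha L mE; rewrite ms mr k_ealpha => skE.
rewrite cE -(mulA (g:=d)); [|ends|ends].
by rewrite skE cov_edge_bar -mulA ?mulgK //; ends.
Qed.

Lemma linked_reduced v0 c0 p v c : linked v0 c0 p v c ->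
  exists2 q, reduced q & linked v0 c0 q v c.
Proof.
elim=> {p v c} [|p v c k _ [q rq qc] vk ck|p e c x _ [q rq qc] cx].
- by exists [::] => //; exact: linked_refl.
- by exists q => //; exact: linked_vert.
have [rfq|nrfq] := pselect (reduced (coset_edge e x c :: q)).
  by exists (coset_edge e x c :: q) => //; exact: linked_edge.
case: q rq qc nrfq => [_ _ []//|f q rfq fqc nrfq].
have fE : f = bar (coset_edge e x c) by apply: contrapT => nf; apply: nrfq.
exists q; first exact: reduced_cons rfq.
by apply: linked_backtrack fqc cx _; rewrite fE.
Qed.

Lemma linked_translate v0 c0 p v c d : linked v0 c0 p v c -> src d = rng c0 ->
  exists p', linked v0 (mul d c0) p' v (mul d c).
Proof.
move=> + dc0; elim=> {p v c} [|p v c k vc [p' IH] vk ck|p e c x vc [p' IH] cx].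
- by exists [::]; exact: linked_refl.
- have cc0 := linked_rng vc.
  exists p'; rewrite mulA; [|ends|ends].
  by apply: linked_vert => //; ends.
- have cc0 := linked_rng vc.
  eexists; rewrite mulA; [|ends|ends].
  by apply: linked_edge IH _; ends.
Qed.

Lemma linked_trans v0 c0 p v c q w d : linked v0 c0 p v c -> linked v c q w d ->
  linked v0 c0 (q ++ p) w d.
Proof.
move=> pc; elim=> {q w d} // [q w d k _ IH wk dk|q e d x _ IH dx].
- exact: linked_vert.
- exact: linked_edge.
Qed.

(** Along the maximal tree the symbols are units by (R1). *)
Lemma linked_tree v w c : exists p, linked v c p w c.
Proof.
have [/is_treeP[cT _] _] := rmt_max Tr.
have sT := maximal_subtree_spanning Tr (@dconnected _ _ _ D).
have [p Tp vp] := cT v w (sT _) (sT _).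
elim: p w Tp vp => [w _ <-|e p IHp w [Te Tp] [<- vp]].
  by exists [::]; exact: linked_refl.
have [q qc] := IHp _ Tp vp; rewrite -term_bar in qc.
pose x := hom_ob proj (src c).
have nbe := tree_untwisted (sub_bar Te).
have dx : twist (bar e) x = idm x by rewrite /twist (negPf nbe).
have cx : src c = u x by rewrite /x cov_projK.
have sE : E (bar e) x = idm (src c).
  by rewrite cx; apply: cov_edge_tree; exact: sub_bar.
have cE : mul c (E (bar e) x) = c by rewrite sE mul_idr.
exists (coset_edge e x c :: q); rewrite -[X in linked _ _ _ _ X]cE.
by apply: linked_edge => //; rewrite dx rng_idm.
Qed.

(** A generator is linked to 1 by going through the tree to the vertex where it
    lives and back; left translation then extends this to all products. *)
Lemma linked_all r c : exists p, linked r (idm (rng c)) p r c.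
Proof.
have step (a c' : arr L) : src a = rng c' ->
    (exists p, linked r (idm (rng c')) p r c') ->
    (exists p, linked r (idm (rng a)) p r a) ->
    exists p, linked r (idm (rng (mul a c'))) p r (mul a c').
  move=> ac' [p pc'] [q qa].
  have [|p' pac'] := linked_translate (d := a) pc'; first by ends.
  move: pac'; rewrite -ac' mul_idr => pac'.
  exists (p' ++ q); rewrite rng_mul //; exact: linked_trans qa pac'.
have cut v w (a : arr L) p : linked v (idm (rng a)) p w a ->
    exists q, linked r (idm (rng a)) q r a.
  move=> va; have [q1 h1] := linked_tree r v (idm (rng a)).
  have [q2 h2] := linked_tree w r a.
  by exists (q2 ++ (p ++ q1)); exact: linked_trans (linked_trans h1 va) h2.
elim/(@cov_ind L): c => [x|v k c vk kc IH|e x c xc IH].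
- by exists [::]; rewrite rng_idm; exact: linked_refl.
- apply: step => //; first by ends.
  apply: (cut v v _ [::]).
  rewrite -[X in linked _ _ _ _ X]mul_idl.
  by apply: linked_vert => //; [exact: linked_refl|ends].
- apply: step => //; first by ends.
  have sx : src (idm (rng (E e x))) = u (rng (twist (bar (bar e)) x)) by ends.
  have := linked_edge (linked_refl _ _) sx; rewrite barK mul_idl; exact: cut.
Qed.

(** A chain from 1 to c traces a closed path; reduced, it is empty. *)
Lemma proj_kernel c : proj c = idm (rng (proj c)) -> c = idm (rng c).
Proof.
move=> c1; have [p pc] := linked_all (root Tr) c.
have [q rq qc] := linked_reduced pc.
have ptE : coset_vertex (root Tr) (idm (rng c)) = coset_vertex (root Tr) c.
  by rewrite /coset_vertex hom_idm -hom_rng -c1.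
have /is_treeP[_ tF] := fiber_tree (rng (proj c)).
have q0 : q = [::].
  apply: (tF (coset_vertex (root Tr) c)) rq.
  - exact: coset_vertex_mom.
  - by have := linked_fiber qc; rewrite hom_idm rng_idm -hom_rng.
  - by have := linked_path qc; rewrite ptE.
have [k [_ vk kc cE]] := linked_nilP qc q0.
have rc : rng c = rng (V (root Tr) k) by rewrite cov_vert_rng // -kc src_idm.
move: cE; rewrite rc mul_idl => cE.
move: c1; rewrite cE (cov_vert_proj L vk) => ->.
by rewrite cov_vert_idm rng_idm.
Qed.

Lemma proj_inj : injective proj.
Proof.
move=> c d cd.
have sE : src c = src d.
  by apply: (can_inj (@cov_projK L)); rewrite -!hom_src cd.
have rE : rng c = rng d.
  by apply: (can_inj (@cov_projK L)); rewrite -!hom_rng cd.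
have := @proj_kernel (mul c (inv d)).
rewrite hom_mul; last by ends.
rewrite hom_inv cd mulgV rng_idm => /(_ erefl) e.
rewrite -[c](mulgKV (h := d)) // e rng_mul; last by ends.
by rewrite rE mul_idl.
Qed.

(** The next edge f of the path is some g.sigma_e(x), and its origin is the
    vertex of the current coset.  So, up to the twist of the origin, g and
    proj(d) differ by an element k of the vertex stabilizer; replacing d by
    another representative of its coset absorbs k. *)
Lemma path_lift r c p w : is_path (coset_vertex r c) p w ->
  exists v d, rng d = rng c /\ coset_vertex v d = w.
Proof.
elim: p w => [w <-|f p IHp w [<- /IHp[v [d [<- dE]]]]]; first by exists r, c.
have [e [g fE]] := esec_cover f.
move: (erefl (src g)) fE; move: {2 3}(src g) => x gx fE.
pose h := mul g (inv (twist (bar e) x)).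
have sh : src h = rng (twist (bar e) x) by rewrite /h; ends.
have hE : vact A h (vsec (term (bar e)) (src h)) = orig f.
  rewrite fE orig_act; last by ends.
  rewrite sh -twist_orig act_mul; [|ends|ends].
  by rewrite /h mulgKV //; ends.
have vE : v = term (bar e).
  by apply: (@vsec_disjoint (proj d) h); rewrite hE.
pose k := mul (inv (proj d)) h.
have dh : hom_ob proj (rng d) = rng h.
  by rewrite -hom_rng -(coset_vertex_mom v) dE -hE; ends.
have vk : vfix v k.
  rewrite /vfix /k src_mul; last by ends.
  rewrite -act_mul; [|ends|ends].
  rewrite vE hE -dE /coset_vertex vE act_mul; [|ends|ends].
  rewrite mulVg rng_mul; last by ends.
  by rewrite rng_inv -{2}(vsec_mom (term (bar e)) (src (proj d))) act_idm.
have dk : src d = u (rng k).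
  by rewrite /k; apply: (can_inj (@cov_projK L)); ends.
have kx : src k = rng (twist (bar e) x) by rewrite /k; ends.
pose c' := mul d (V v k).
have c'x : src c' = u (rng (twist (bar e) x)) by rewrite /c'; ends.
exists (term e), (mul c' (E (bar e) x)).
split; first by rewrite /c'; ends.
rewrite -coset_edge_term // fE; congr (term (act _ _ _)).
rewrite /c' hom_mul; last by ends.
rewrite cov_vert_proj // /k mulKVg; last by ends.
by rewrite /h mulgKV //; ends.
Qed.

Lemma proj_surj g : exists c, proj c = g.
Proof.
pose r := root Tr; pose c := idm (u (rng g)) : arr L.
have /is_treeP[cF _] := fiber_tree (rng g).
have [||p _ /path_lift[v [d [dc dE]]]] :=
    cF (coset_vertex r c) (vact A g (vsec r (src g))).
- by rewrite /= coset_vertex_mom /c; ends.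
- by rewrite /=; ends.
have vE : v = r by apply: (@vsec_disjoint (proj d) g).
have dg : hom_ob proj (rng d) = rng g by rewrite dc /c; ends.
pose k := mul (inv (proj d)) g.
have rk : hom_ob proj (src d) = rng k by rewrite /k; ends.
have vk : vfix r k.
  rewrite /vfix -rk /k src_mul; last by ends.
  rewrite -act_mul; [|ends|ends].
  rewrite -dE /coset_vertex vE hom_src act_mul; [|ends|ends].
  by rewrite mulVg hom_src -{2}(vsec_mom r (hom_ob proj (src d))) act_idm.
exists (mul d (V r k)); rewrite hom_mul; last first.
  by apply: (can_inj (@cov_projK L)); ends.
by rewrite (cov_vert_proj L vk) mulKVg //; ends.
Qed.

Lemma cover_isomorphic : isomorphic G L.
Proof.
exact: isomorphic_of_bij (@cov_projK L) (@cov_obK L) proj_inj proj_surj.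
Qed.

End BassSerre.

(** * The fundamental groupoid as a cover of G *)

Notation GG := (desing_gog D).
Notation Pi := (pi1 wideD Tr).

(** The transport along [egrp_bar] in [alpha_bar] does not change underlying
    elements of G, whatever the equality of edges it comes from. *)
Lemma hom_cast_val (a b : edge Gam) (E : a = b) (H : groupoid)
    (f : groupoid_hom (Stab (eact A) (sige a)) H) :
  let f' := hom_cast (congr1
    (fun e => groupoid_of_subgroupoid (Stab (eact A) (sige e))) E) f in
  (forall z, exists2 z', proj1_sig z' = proj1_sig z & hom_ob f' z = hom_ob f z')
  /\ (forall g, exists2 g', proj1_sig g' = proj1_sig g & f' g = f g').
Proof. by case: b / E; split=> z; exists z. Qed.

Lemma alpha_bar_ob e (z : ob (egrp GG e)) :
  proj1_sig (hom_ob (alpha_bar GG e) z) = rng (twist (bar e) (proj1_sig z)).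
Proof.
have [/(_ z)[z' zz' E] _] := hom_cast_val (pos_edge_bar e) (dalpha (bar e)).
by rewrite -zz' -dalpha_obE; exact: (congr1 (@proj1_sig _ _) E).
Qed.

Lemma alpha_bar_arr e (g : arr (egrp GG e)) :
  proj1_sig (alpha_bar GG e g) = ealpha (bar e) (proj1_sig g).
Proof.
have [_ /(_ g)[g' gg' E]] := hom_cast_val (pos_edge_bar e) (dalpha (bar e)).
by rewrite -gg' -dalpha_arrE; exact: (congr1 (@proj1_sig _ _) E).
Qed.

Lemma alpha_arr e (g : arr (egrp GG e)) :
  proj1_sig (alpha GG e g) = ealpha e (proj1_sig g).
Proof. exact: dalpha_arrE. Qed.

Definition unit_val (s : units GG) : ob G := proj1_sig (projT2 s).

Lemma unit_val_inj (s t : units GG) :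
  projT1 s = projT1 t -> unit_val s = unit_val t -> s = t.
Proof.
case: s t => v s [w t] /= vw; case: w / vw t => t st.
by congr existT; exact: sig_eq.
Qed.

(** The tree edges identify units with the same underlying unit of G. *)
Lemma unit_val_tau s : proj1_sig (tau wideD Tr s) = unit_val s.
Proof.
rewrite /tau; case: cid => t /= st.
suff : unit_val s = unit_val (unit_at t) by [].
elim: st => {s t} [s t [e Te [z [<- <-]]]|//|s t _ ->//|s s' t _ -> _ ->//].
rewrite /unit_val /= alpha_bar_ob dalpha_obE.
by rewrite /twist !(negPf (tree_untwisted _)) ?rng_idm //; exact: sub_bar.
Qed.

Lemma vsec_dom (v : vert Gam) x : sub_ob (vstab v) x.
Proof. by rewrite /= /pdom /= vsecE. Qed.

Lemma esec_dom (e : edge Gam) x : sub_ob (estab e) x.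
Proof. by rewrite /= /pdom /= esecE. Qed.

Definition pi1_ob (x : ob G) : ob Pi := exist _ x (vsec_dom (root Tr) x).

Definition vertex_unit v x : ob (vgrp GG v) := exist _ x (vsec_dom v x).

Definition edge_unit e x : ob (egrp GG e) := exist _ x (esec_dom e x).

Lemma pi1_ob_eq (a : ob Pi) x : proj1_sig a = x -> a = pi1_ob x.
Proof. by move=> ax; exact: sig_eq. Qed.

(** The morphism to G on generators.  For the symbol (y, x) of e the unit z of
    the edge groupoid is recovered from the end at which [twist] is trivial:
    that is x when e is twisted, and y otherwise. *)
Definition gen_val (a : pi1_gen GG) : arr G :=
  match a with
  | Vgen v g => proj1_sig (g : sg_arr (vstab v))
  | Sgen e x y _ => let z := if twisted e then unit_val x else unit_val y in
    mul (twist e z) (inv (twist (bar e) z))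
  end.

Lemma phi_unit_val e s t : phi e s t ->
  exists z, unit_val s = rng (twist (bar e) z) /\ unit_val t = rng (twist e z).
Proof.
case=> z [<- <-]; exists (proj1_sig z).
by rewrite /unit_val /= alpha_bar_ob dalpha_obE.
Qed.

Lemma gen_val_Sgen e s t (p : phi e s t) z :
  unit_val s = rng (twist (bar e) z) -> unit_val t = rng (twist e z) ->
  gen_val (Sgen p) = mul (twist e z) (inv (twist (bar e) z)).
Proof.
move=> sz tz; rewrite /gen_val; set z' := (if _ then _ else _).
suff -> : z' = z by [].
rewrite /z'; case: ifPn => te; last by rewrite tz /twist (negPf te) rng_idm.
have [|nbe] := untwisted_or e; first by rewrite te.
by rewrite sz /twist (negPf nbe) rng_idm.
Qed.

Lemma gen_val_src a : src (gen_val a) = proj1_sig (pi1_gen_src wideD Tr a).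
Proof.
case: a => [v g|e s t p]; first by rewrite unit_val_tau.
have [z [sz tz]] := phi_unit_val p.
rewrite (gen_val_Sgen p sz tz) unit_val_tau sz.
by rewrite src_mul ?src_inv // rng_inv !twist_src.
Qed.

Lemma gen_val_rng a : rng (gen_val a) = proj1_sig (pi1_gen_rng wideD Tr a).
Proof.
case: a => [v g|e s t p]; first by rewrite unit_val_tau.
have [z [sz tz]] := phi_unit_val p.
rewrite (gen_val_Sgen p sz tz) unit_val_tau tz.
by rewrite rng_mul // rng_inv !twist_src.
Qed.

Lemma gen_val_phi_sym e s t (p : phi e s t) :
  gen_val (Sgen (phi_sym p)) = inv (gen_val (Sgen p)).
Proof.
have [z [sz tz]] := phi_unit_val p; rewrite (gen_val_Sgen p sz tz).
rewrite (@gen_val_Sgen _ _ _ (phi_sym p) z) ?barK // invM ?invK //.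
by rewrite rng_inv !twist_src.
Qed.

Notation grng := (pi1_gen_rng wideD Tr).
Notation gsrc := (pi1_gen_src wideD Tr).
Notation fo := (fun x : ob (vgrp GG (root Tr)) => proj1_sig x).
Notation val := (eval fo gen_val).
Notation letter := (letter (pi1_gen GG)).

Lemma lval_src (a : letter) : src (leval gen_val a) = fo (lsrc grng gsrc a).
Proof. exact: leval_src gen_val_src gen_val_rng a. Qed.

Lemma chain_behead y x (a : letter) l :
  chain grng gsrc y (a :: l) x -> chain grng gsrc (lsrc grng gsrc a) l x.
Proof. by case. Qed.

Lemma val1 y x (a : letter) : chain grng gsrc y [:: a] x ->
  val x [:: a] = leval gen_val a.
Proof. by case=> _ /= <-; rewrite -lval_src mul_idr. Qed.

Lemma val_cons y x (a b : letter) l : chain grng gsrc y [:: a, b & l] x ->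
  val x [:: a, b & l] = mul (leval gen_val a) (val x (b :: l)) /\
  src (leval gen_val a) = rng (val x (b :: l)).
Proof.
move=> [_ c]; split=> //; rewrite lval_src.
have cb : chain grng gsrc (lsrc grng gsrc a) (b :: l) x := c.
by have [_ ->] := eval_ends gen_val_src gen_val_rng cb.
Qed.

Lemma conj_telescope (b b' k c c' : arr G) :
  src b = rng k -> src b' = rng k -> src c = src k -> src c' = src k ->
  mul (mul b (inv b')) (mul (mul (mul b' k) (inv c')) (inv (mul c (inv c')))) =
  mul (mul b k) (inv c).
Proof.
move=> bk b'k ck c'k; rewrite invM ?invK; last by ends.
rewrite -(mulA (g := mul b' k)) ?mulKg //; [|ends|ends|ends].
rewrite -(mulA (g := b') (h := k)); [|ends|ends].
by rewrite -mulA ?mulKg ?mulA //; ends.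
Qed.

Lemma gen_val_phi_alpha e (z : ob (egrp GG e)) :
  gen_val (Sgen (phi_alpha z)) =
  mul (twist e (proj1_sig z)) (inv (twist (bar e) (proj1_sig z))).
Proof.
by apply: gen_val_Sgen; rewrite /unit_val /= ?alpha_bar_ob ?dalpha_obE.
Qed.

Lemma gen_val_R2 e (g : arr (egrp GG e)) :
  mul (gen_val (Sgen (phi_alpha (rng g))))
    (mul (gen_val (Vgen (alpha_bar GG e g)))
       (gen_val (Sgen (phi_sym (phi_alpha (src g)))))) =
  gen_val (Vgen (alpha GG e g)).
Proof.
rewrite gen_val_phi_sym !gen_val_phi_alpha.
rewrite [gen_val (Vgen (alpha_bar _ _ _))]alpha_bar_arr.
rewrite [RHS]alpha_arr.
by apply: conj_telescope; rewrite twist_src.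
Qed.

Lemma gen_val_rel l l' y x : pi1_rel Tr l l' -> chain grng gsrc y l x ->
  chain grng gsrc y l' x -> val x l = val x l'.
Proof.
case=> {l l'} [v g h gh|v z|e s t p|e s t p Te|e g] c c'.
- have [-> _] := val_cons c; case: c => _ c; rewrite (val1 c) (val1 c').
  exact/esym/(sg_mulE gh).
- rewrite (val1 c) /leval /= -c'.
  by case: c => <- _; rewrite unit_val_tau /unit_val /= rng_idm.
- rewrite (val1 c) (val1 c'); exact/esym/gen_val_phi_sym.
- have [z [sz tz]] := phi_unit_val p.
  rewrite (val1 c) -c' /leval; case: c => <- _.
  rewrite [X in X = _](gen_val_Sgen p sz tz).
  rewrite /lrng /= unit_val_tau tz.
  rewrite /twist !(negPf (tree_untwisted _)) //; last exact: sub_bar.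
  by have := mul_idr (idm z); rewrite inv_idm src_idm rng_idm.
- have [-> _] := val_cons c; have {}c := chain_behead c.
  have [-> _] := val_cons c; have {}c := chain_behead c.
  rewrite (val1 c) (val1 c'); exact: gen_val_R2.
Qed.

Definition pi1_proj : groupoid_hom Pi G :=
  pres_hom gen_val_src gen_val_rng gen_val_rel.

Notation larr := (@larr _ _ grng gsrc (pi1_rel Tr)).

Lemma larr_pos (a : pi1_gen GG) :
  src (larr (lpos a)) = gsrc a /\ rng (larr (lpos a)) = grng a.
Proof. by rewrite larr_src larr_rng. Qed.

Lemma pi1_proj_larr a : pi1_proj (larr (lpos a)) = gen_val a.
Proof. exact: pres_hom_larr. Qed.

Lemma gsrc_pi1_ob a : gsrc a = pi1_ob (src (gen_val a)).
Proof. by apply: pi1_ob_eq; rewrite gen_val_src. Qed.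

Lemma grng_pi1_ob a : grng a = pi1_ob (rng (gen_val a)).
Proof. by apply: pi1_ob_eq; rewrite gen_val_rng. Qed.

(** The proof that k stabilizes the section is found inside the term, so that v
    and k are free to be rewritten; elsewhere the value is arbitrary. *)
Definition pi1_vert (v : vert Gam) (k : arr G) : arr Pi :=
  if pselect (vfix v k) is left vk then
    larr (lpos (Vgen (exist _ k ((vfixP v k).1 vk) : arr (vgrp GG v))))
  else idm (pi1_ob (src k)).

Definition pi1_edge (e : edge Gam) (x : ob G) : arr Pi :=
  larr (lpos (Sgen (phi_alpha (edge_unit e x)))).

Lemma pi1_vert_larr v (g : arr (vgrp GG v)) :
  larr (lpos (Vgen g)) = pi1_vert v (proj1_sig g).
Proof.
rewrite /pi1_vert; case: pselect => [vk|[]]; last first.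
  exact: (vfixP v _).2 (proj2_sig g).
by congr (larr (lpos (Vgen _))); exact: sig_eq.
Qed.

Lemma pi1_vert_fix v k : vfix v k ->
  exists2 g : arr (vgrp GG v),
    proj1_sig g = k & pi1_vert v k = larr (lpos (Vgen g)).
Proof.
move=> vk; exists (exist _ k ((vfixP v k).1 vk)) => //.
by rewrite pi1_vert_larr.
Qed.

Lemma pi1_vert_src v k : vfix v k -> src (pi1_vert v k) = pi1_ob (src k).
Proof.
by move=> /pi1_vert_fix[g <- ->]; rewrite (larr_pos _).1 gsrc_pi1_ob.
Qed.

Lemma pi1_vert_rng v k : vfix v k -> rng (pi1_vert v k) = pi1_ob (rng k).
Proof.
by move=> /pi1_vert_fix[g <- ->]; rewrite (larr_pos _).2 grng_pi1_ob.
Qed.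

Lemma pi1_vert_proj v k : vfix v k -> pi1_proj (pi1_vert v k) = k.
Proof. by move=> /pi1_vert_fix[g <- ->]; rewrite pi1_proj_larr. Qed.

Lemma pi1_vert_mul v k l : vfix v k -> vfix v l -> src k = rng l ->
  pi1_vert v (mul k l) = mul (pi1_vert v k) (pi1_vert v l).
Proof.
move=> /pi1_vert_fix[g <- ->] /pi1_vert_fix[h <- ->] gh.
have {}gh : src g = rng h by exact: sig_eq.
rewrite -(sg_mulE gh) -pi1_vert_larr.
set a := lpos (Vgen g); set b := lpos (Vgen h).
have ba : lsrc grng gsrc b = lsrc grng gsrc (lpos (Vgen (mul g h))).
  by congr (tau _ _ (unit_at _)); rewrite (@src_mul (vgrp GG v)).
rewrite -[LHS]lprod1 -[X in _ = mul _ X]lprod1 -ba.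
apply/esym/(@lprod_rel _ _ _ _ _ [:: a; b] _ (lrng grng gsrc a)).
- exact: rel_mul.
- by do 2!split=> //; congr (tau _ _ (unit_at _)).
- split; last by rewrite -ba.
  by congr (tau _ _ (unit_at _)); rewrite (@rng_mul (vgrp GG v)).
Qed.

Lemma pi1_vert_idm v x : pi1_vert v (idm x) = idm (pi1_ob x).
Proof.
have -> : pi1_vert v (idm x) = larr (lpos (Vgen (idm (vertex_unit v x)))).
  by rewrite pi1_vert_larr.
set a := Vgen _.
have ax : lsrc grng gsrc (lpos a) = pi1_ob x.
  by rewrite [LHS]gsrc_pi1_ob /= src_idm.
rewrite -lprod1 ax; apply: (@lprod_rel _ _ _ _ _ _ [::] (pi1_ob x)) => //.
- exact: rel_unit.
- by rewrite /= ax; split=> //; rewrite [LHS]grng_pi1_ob /= rng_idm.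
Qed.

Lemma pi1_edge_ends e s t (p : phi e s t) :
  exists z, [/\ larr (lpos (Sgen p)) = pi1_edge e z,
    unit_val s = rng (twist (bar e) z) & unit_val t = rng (twist e z)].
Proof.
case: (p) => z []; have -> : z = edge_unit e (proj1_sig z) by exact: sig_eq.
move=> sE tE; exists (proj1_sig z); subst s t; split.
- by congr (larr (lpos (Sgen _))); exact: Prop_irrelevance.
- by rewrite /unit_val /= alpha_bar_ob.
- by rewrite /unit_val /= dalpha_obE.
Qed.

Lemma pi1_edge_src e x : src (pi1_edge e x) = pi1_ob (rng (twist (bar e) x)).
Proof.
rewrite (larr_pos _).1 gsrc_pi1_ob gen_val_phi_alpha src_mul ?src_inv //.
by rewrite rng_inv !twist_src.
Qed.

Lemma pi1_edge_rng e x : rng (pi1_edge e x) = pi1_ob (rng (twist e x)).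
Proof.
rewrite (larr_pos _).2 grng_pi1_ob gen_val_phi_alpha rng_mul //.
by rewrite rng_inv !twist_src.
Qed.

Lemma pi1_edge_proj e x :
  pi1_proj (pi1_edge e x) = mul (twist e x) (inv (twist (bar e) x)).
Proof. by rewrite pi1_proj_larr gen_val_phi_alpha. Qed.

Lemma Sgen_inv e s t (p : phi e s t) :
  larr (lpos (Sgen (phi_sym p))) = inv (larr (lpos (Sgen p))).
Proof.
rewrite -larr_inv -!lprod1.
apply/esym/(@lprod_rel _ _ _ _ _ _ _ (lrng grng gsrc (lneg (Sgen p)))) => //.
exact: rel_inv.
Qed.

Lemma Sgen_eq e (s t s' t' : units GG) (p : phi e s t) (p' : phi e s' t') :
  s = s' -> t = t' -> Sgen p = Sgen p'.
Proof.
by move=> ss tt; subst s' t'; rewrite (Prop_irrelevance p p').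
Qed.

Lemma pi1_edge_bar e x : pi1_edge (bar e) x = inv (pi1_edge e x).
Proof.
rewrite -Sgen_inv; congr (larr (lpos _)); apply: Sgen_eq; apply: unit_val_inj.
- by rewrite /= barK.
- by rewrite /unit_val /= alpha_bar_ob dalpha_obE /= barK.
- by [].
- by rewrite /unit_val /= alpha_bar_ob dalpha_obE /=.
Qed.

Lemma pi1_edge_tree e x : sub_edge Tr e -> pi1_edge e x = idm (pi1_ob x).
Proof.
move=> Te; set a := Sgen (phi_alpha (edge_unit e x)).
have de1 f : sub_edge Tr f -> rng (twist f x) = x.
  by move=> Tf; rewrite /twist (negPf (tree_untwisted Tf)) rng_idm.
have ax : lsrc grng gsrc (lpos a) = pi1_ob x.
  by have := pi1_edge_src e x; rewrite (larr_pos _).1 de1 //; exact: sub_bar.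
have xa : lrng grng gsrc (lpos a) = pi1_ob x.
  by have := pi1_edge_rng e x; rewrite (larr_pos _).2 de1.
rewrite /pi1_edge -lprod1 ax.
apply: (@lprod_rel _ _ _ _ _ _ [::] (pi1_ob x)) => //.
exact: rel_R1.
Qed.

(** (R2), with its last letter moved to the other side. *)
Lemma pi1_edge_ealpha e k : efix e k ->
  mul (pi1_edge e (rng k)) (pi1_vert (term (bar e)) (ealpha (bar e) k)) =
  mul (pi1_vert (term e) (ealpha e k)) (pi1_edge e (src k)).
Proof.
move=> ek; pose g : arr (egrp GG e) := exist _ k ((efixP e k).1 ek).
have gr : rng g = edge_unit e (rng k) by exact: sig_eq.
have gs : src g = edge_unit e (src k) by exact: sig_eq.
have Vo : pi1_vert (term (bar e)) (ealpha (bar e) k) =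
    larr (lpos (Vgen (alpha_bar GG e g))).
  by rewrite pi1_vert_larr alpha_bar_arr.
have Vt : pi1_vert (term e) (ealpha e k) = larr (lpos (Vgen (alpha GG e g))).
  by rewrite pi1_vert_larr alpha_arr.
have vo : vfix (term (bar e)) (ealpha (bar e) k).
  by apply: vfix_ealpha; exact: efix_bar.
have vt := vfix_ealpha ek.
set a1 := lpos (Sgen (phi_alpha (rng g))).
set a2 := lpos (Vgen (alpha_bar GG e g)).
set a3 := lpos (Sgen (phi_sym (phi_alpha (src g)))).
set b := lpos (Vgen (alpha GG e g)).
have E1 : larr a1 = pi1_edge e (rng k) by rewrite /a1 gr.
have E3 : larr a3 = inv (pi1_edge e (src k)) by rewrite /a3 gs Sgen_inv.
have R := @lprod_rel _ _ grng gsrc _ _ _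
  (lrng grng gsrc a1) (lsrc grng gsrc a3) (rel_R2 Tr g).
have sl (a : letter) : lsrc grng gsrc a = src (larr a) by rewrite larr_src.
have rl (a : letter) : lrng grng gsrc a = rng (larr a) by rewrite larr_rng.
have c1 : lrng grng gsrc a2 = lsrc grng gsrc a1.
  rewrite (rl a2) (sl a1) -Vo E1.
  by rewrite pi1_vert_rng // pi1_edge_src ealpha_rng.
have c2 : lrng grng gsrc a3 = lsrc grng gsrc a2.
  rewrite (rl a3) (sl a2) -Vo E3.
  by rewrite pi1_vert_src // rng_inv pi1_edge_src ealpha_src.
have c3 : lrng grng gsrc b = lrng grng gsrc a1.
  rewrite (rl b) (rl a1) -Vt E1.
  by rewrite pi1_vert_rng // pi1_edge_rng ealpha_rng.
have c4 : lsrc grng gsrc b = lsrc grng gsrc a3.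
  rewrite (sl b) (sl a3) -Vt E3.
  by rewrite pi1_vert_src // src_inv pi1_edge_rng ealpha_src.
have {R} : mul (larr a1) (mul (larr a2) (larr a3)) = larr b.
  by rewrite -[larr a3]lprod1 -[larr b]lprod1 c4; exact: R.
rewrite E1 E3 -Vo -Vt => <-.
have vs : src (pi1_vert (term (bar e)) (ealpha (bar e) k)) =
    src (pi1_edge e (src k)).
  by rewrite pi1_vert_src // pi1_edge_src ealpha_src.
have vr : src (pi1_edge e (rng k)) =
    rng (pi1_vert (term (bar e)) (ealpha (bar e) k)).
  by rewrite pi1_vert_rng // pi1_edge_src ealpha_rng.
rewrite -mulA ?rng_mul ?src_mul ?src_inv ?rng_inv //.
by rewrite mulgKV.
Qed.

Lemma pi1_vert_inv v k : vfix v k -> inv (pi1_vert v k) = pi1_vert v (inv k).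
Proof.
move=> vk; have vk' : vfix v (inv k).
  by apply/vfixP; apply: stab_inv; apply/vfixP.
apply/esym/inv_uniq; first by rewrite pi1_vert_src // pi1_vert_rng // src_inv.
by rewrite -pi1_vert_mul ?src_inv // mulVg pi1_vert_idm pi1_vert_src.
Qed.

(** Inverse letters are letters again: by the vertex groupoids for [Vgen], by
    the symbol of the opposite edge for [Sgen]. *)
Lemma pi1_ind (Q : arr Pi -> Prop) :
  (forall x, Q (idm (pi1_ob x))) ->
  (forall v k c, vfix v k -> pi1_ob (src k) = rng c -> Q c ->
     Q (mul (pi1_vert v k) c)) ->
  (forall e x c, pi1_ob (rng (twist (bar e) x)) = rng c -> Q c ->
     Q (mul (pi1_edge e x) c)) ->
  forall c, Q c.
Proof.
move=> Q1 Qv Qe; elim/presented_ind => [x|a c ac Qc].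
  by rewrite (_ : x = pi1_ob (proj1_sig x)) //; exact: pi1_ob_eq.
have ra : src (larr a) = rng c by rewrite larr_src.
suff [[v [k vk aE]]|[e [x aE]]] :
    (exists v, exists2 k, vfix v k & larr a = pi1_vert v k) \/
    (exists e x, larr a = pi1_edge e x).
- by rewrite aE in ra *; apply: Qv => //; rewrite -(pi1_vert_src vk).
- by rewrite aE in ra *; apply: Qe => //; rewrite -pi1_edge_src.
have fixg v (g : arr (vgrp GG v)) : vfix v (proj1_sig g).
  exact: (vfixP v _).2 (proj2_sig g).
have negE b : larr (lneg b) = inv (larr (lpos b)) by rewrite -larr_inv.
case: a {ac ra} => [[v g|e s t p] [|]]; [left|left|right|right].
- by exists v, (proj1_sig g) => //; exact: pi1_vert_larr.
- exists v, (inv (proj1_sig g)).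
    by apply/vfixP; apply: stab_inv; exact: (proj2_sig g).
  by rewrite [LHS]negE pi1_vert_larr pi1_vert_inv.
- by have [z [pE _ _]] := pi1_edge_ends p; exists e, z.
- have [z [pE _ _]] := pi1_edge_ends p; exists (bar e), z.
  by rewrite [LHS]negE pE pi1_edge_bar.
Qed.

Definition pi1_cover : cover.
Proof.
refine (@Cover Pi pi1_proj pi1_ob _ _ pi1_vert pi1_vert_src pi1_vert_rng
  pi1_vert_idm pi1_vert_mul pi1_vert_proj pi1_edge pi1_edge_src pi1_edge_rng
  pi1_edge_bar pi1_edge_tree
  pi1_edge_proj pi1_edge_ealpha pi1_ind).
- by [].
- by move=> x; apply/esym/pi1_ob_eq.
Defined.

End WideDesingularization.

Theorem theoremA (G : groupoid) (F : graph) (A : graph_action G F)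
    (noinv : without_inversion A) (forestF : is_forest F)
    (fiber_tree : forall x : ob G, is_tree (fiber A x))
    (D : desingularization A) (wideD : wide (desing_gog D)) :
  isomorphic G (pi1 wideD (dtree D)).
Proof. exact: (cover_isomorphic fiber_tree (pi1_cover fiber_tree wideD)). Qed.
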